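(* The ordinary differential equation $$a''''+120(a')^3a''-120a'a''t-\tfrac{200}3(a')^2-\tfrac{40}3aa''+\tfrac{200}9t=0,\qquad (\ )'=\tfrac{d}{dt},$$ for $a=a(t)$ does not possess the Painlevé property. Namely, it is satisfied by a $4$-parameter Puiseux series in powers of $(t-b)^{1/3}$: for arbitrary complex values of the parameters $b,a_0,a_9,a_{11}$ it admits a formal series solution $$a(t)=\sum_{k=0}^\infty a_k(t-b)^{k/3}$$ with initial terms $$a_1=-1,\quad a_2=a_3=a_4=0,\quad a_5=-\tfrac67b,\quad a_6=0,\quad a_7=\tfrac{10}{21}a_0,\quad a_8=-\tfrac32,\quad a_{10}=0,\quad a_{12}=-\tfrac{135}{49}b.$$
   Context: An ODE has the (analytic) Painlevé property if its general solution is free from branch points and essential singularities whose location depends on the specific choice of the initial data (no movable critical or essential singularities), so that solutions extend meromorphically to the universal covering of a punctured Riemann surface with punctures determined by the equation itself. *)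

(* Defs.v *)
(* Standard-library reals, with the complex numbers C of Coquelicot. *)
From Stdlib Require Import Reals ZArith.
From Coquelicot Require Import Coquelicot.

Open Scope C_scope.

(** ** Ordinary differential equations in the complex domain *)

(* [E t y] is the left-hand side of an equation [E t y = 0], where [y k]
   stands for the [k]-th derivative of the unknown function at [t]. *)
Definition ode := C -> (nat -> C) -> C.

(* [d k] is the [k]-th complex derivative of the holomorphic function [f]
   on the open disc with centre [t0] and radius [r]. *)
Definition solves_on_disc (E : ode) (t0 : C) (r : R) (f : C -> C) : Prop :=
  exists d : nat -> C -> C,
    forall z : C, (Cmod (z - t0) < r)%R ->
      d O z = f z /\
      (forall k : nat, is_derive (K := C_AbsRing) (V := C_NormedModule)
                         (d k) z (d (S k) z)) /\
      E z (fun k => d k z) = 0.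

(** ** Meromorphic functions on the universal covering of a plane domain *)

(* A convergent Laurent expansion with finite principal part on a punctured
   disc; the value at the centre, where there may be a pole, is irrelevant. *)
Definition meromorphic_at (h : C -> C) (c : C) : Prop :=
  exists (r : R) (n : nat) (u : nat -> C),
    (0 < r)%R /\
    forall z : C, (0 < Cmod (z - c) < r)%R ->
      is_pseries (K := C_AbsRing) (V := C_NormedModule)
        u (z - c) ((z - c) ^ n * h z).

(* Only the restriction of a path to [0,1] matters; a continuous map on [0,1]
   is extended to R by constants. The same holds for homotopies. *)
Definition is_path (X : C -> Prop) (x y : C) (g : R -> C) : Prop :=
  (forall s : R, continuous g s) /\
  g 0%R = x /\ g 1%R = y /\
  forall s : R, (0 <= s <= 1)%R -> X (g s).

Definition homotopic (X : C -> Prop) (x y : C) (g h : R -> C) : Prop :=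
  exists H : R * R -> C,
    (forall p : R * R, continuous H p) /\
    (forall s u : R, (0 <= s <= 1)%R -> (0 <= u <= 1)%R -> X (H (s, u))) /\
    (forall s : R, (0 <= s <= 1)%R -> H (s, 0%R) = g s /\ H (s, 1%R) = h s) /\
    (forall u : R, (0 <= u <= 1)%R -> H (0%R, u) = x /\ H (1%R, u) = y).

Definition segment (x y : C) : R -> C := fun s => x + RtoC s * (y - x).

Definition concat (g h : R -> C) : R -> C :=
  fun s => if Rle_dec s (1 / 2) then g (2 * s)%R else h (2 * s - 1)%R.

(* The universal covering of the open set [X] with base point [t0] is the set
   of homotopy classes of paths in [X] issued from [t0]; near the class of a
   path [g] ending at [y] it is parametrised by [z] near [y], through the class
   of [g] followed by the segment from [y] to [z]. So [F] below is a meromorphic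
   function on this covering, extending the germ of [f] at [t0]. *)
Definition extends_to_universal_covering
    (X : C -> Prop) (t0 : C) (f : C -> C) : Prop :=
  exists F : (R -> C) -> C,
    (forall (y : C) (g h : R -> C),
       is_path X t0 y g -> is_path X t0 y h -> homotopic X t0 y g h ->
       F g = F h) /\
    (forall (y : C) (g : R -> C),
       is_path X t0 y g ->
       meromorphic_at (fun z => F (concat g (segment y z))) y) /\
    (exists r : R, (0 < r)%R /\
       forall z : C, (Cmod (z - t0) < r)%R -> F (segment t0 z) = f z).

(** ** The Painlevé property *)

Definition closed_discrete (S : C -> Prop) : Prop :=
  forall z : C, exists r : R, (0 < r)%R /\
    forall w : C, S w -> ~ (0 < Cmod (w - z) < r)%R.

(* The punctures [S] are chosen before the solution: they depend on the equation
   alone, not on the initial data. For an equation solved for its highest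
   derivative, with entire coefficients, there are no singular solutions, and
   the general solution comprises all local holomorphic solutions. *)
Definition painleve_property (E : ode) : Prop :=
  exists S : C -> Prop,
    closed_discrete S /\
    forall (t0 : C) (r : R) (f : C -> C),
      ~ S t0 -> (0 < r)%R -> solves_on_disc E t0 r f ->
      extends_to_universal_covering (fun z => ~ S z) t0 f.

(** ** Formal Puiseux series in powers of [(t - b)^(1/3)] *)

(* The formal sum over [k : nat] of [pcoef k * (t - b)^((pord + k) / 3)];
   [pcoef 0] may vanish, so a series has several representations, and is
   zero when all its coefficients [coefficient f j], [j : Z], are. *)
Record puiseux := Puiseux { pord : Z; pcoef : nat -> C }.

Definition coefficient (f : puiseux) (j : Z) : C :=
  if Z_lt_dec j (pord f) then 0 else pcoef f (Z.to_nat (j - pord f)).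

Definition padd (f g : puiseux) : puiseux :=
  let m := Z.min (pord f) (pord g) in
  Puiseux m (fun k => coefficient f (m + Z.of_nat k)
                      + coefficient g (m + Z.of_nat k)).

Definition pscal (c : C) (f : puiseux) : puiseux :=
  Puiseux (pord f) (fun k => c * pcoef f k).

Definition pmul (f g : puiseux) : puiseux :=
  Puiseux (pord f + pord g)
    (fun k => sum_n (G := C_AbelianMonoid)
                (fun i => pcoef f i * pcoef g (k - i)%nat) k).

(* d/dt of (t - b)^(j/3) is (j/3) (t - b)^((j-3)/3). *)
Definition pderiv (f : puiseux) : puiseux :=
  Puiseux (pord f - 3)
    (fun k => RtoC (IZR (pord f + Z.of_nat k) / 3) * pcoef f k).

(* The independent variable t = b + (t - b). *)
Definition pvar (b : C) : puiseux :=
  Puiseux 0 (fun k => match k with 0%nat => b | 3%nat => 1 | _ => 0 end).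

Declare Scope puiseux_scope.
Delimit Scope puiseux_scope with puiseux.
Infix "+" := padd : puiseux_scope.
Infix "*" := pmul : puiseux_scope.
Infix "*:" := pscal (at level 40) : puiseux_scope.

(** ** The equation *)

Definition the_ode : ode := fun t y =>
  y 4%nat + 120 * y 1%nat ^ 3 * y 2%nat - 120 * y 1%nat * y 2%nat * t
  - 200 / 3 * y 1%nat ^ 2 - 40 / 3 * y 0%nat * y 2%nat + 200 / 9 * t.

(* The same left-hand side, for the formal series a = sum_k a_k (t - b)^(k/3). *)
Definition formal_lhs (b : C) (a : nat -> C) : puiseux :=
  let t := pvar b in
  let y := Puiseux 0 a in
  let y1 := pderiv y in
  let y2 := pderiv y1 in
  let y4 := pderiv (pderiv y2) in
  (y4 + 120 *: (y1 * y1 * y1 * y2) + (- (120))%C *: (y1 * y2 * t)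
   + (- (200 / 3))%C *: (y1 * y1) + (- (40 / 3))%C *: (y * y2)
   + (200 / 9)%C *: t)%puiseux.

Definition formal_solution (b : C) (a : nat -> C) : Prop :=
  forall j : Z, coefficient (formal_lhs b a) j = 0.

(* Main.v *)
(** Writing [w = (t - b)^(1/3)], the equation for [a = a0 - w + w^5 e] becomes,
    up to a constant and a power of [w], [Lambda e + A0 + w^4 M(e) = 0], where [Lambda] multiplies the [n]-th
    coefficient by [(n + 5)(n + 7)(n - 4)(n - 6)], [A0] is a
    polynomial and [M] is a polynomial expression in [e] and its weighted
    variants. Hence the coefficients of [e] are determined recursively, except at
    the resonances [n = 4, 6], where the compatibility conditions hold and [a9],
    [a11] are free. The factor [w^4] also makes partial sums of
    [sum (n + 5)^2 |e_n| r^n] satisfy [S_(K+1) <= H + r B(S_K)], so that the series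
    converges for small [w].

    For [b] outside the fixed punctures, a branch of the sum near a point
    [t0 = b + x0^3] is thus a local solution. If it extended meromorphically to the
    universal covering, then, paths in a disc being homotopic, it would extend to a
    function with Laurent expansions at all points [b + s], [0 <= s <= x0^3]. The
    branch being real analytic in [s > 0], the identity principle along this
    segment shows that its real part equals a Laurent series in [s = x^3] for small
    [x > 0], which contradicts the term [- x] of the expansion. *)

Require Import Defs.
From Stdlib Require Import Reals.
From Stdlib Require Import ZArith Lia Lra FunctionalExtensionality Classical.
From Coquelicot Require Import Coquelicot.

Open Scope C_scope.

(** * Formal power series *)

(** For [a ~ c w] the balance of [a''''] with [120 a'^3 a''] forces [c^4 + c = 0]; the choice
    [c = -1] is no restriction, as the other cube roots of -1 amount to another branch of [w]. In
    terms of the exponent [j = n + 5] the resonance polynomial reads [j (j + 2) (j - 9) (j - 11)]: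
    besides the free [a9] and [a11], the root 0 reflects the parameter [a0], and the root -2 the
    parameter [b], because the derivative of [-w] with respect to [b] is [w^(-2) / 3].

    The identity principle is applied to real parts on a real segment, so that no Cauchy theory
    enters: real analyticity of the branch follows from Taylor's formula and bounds of type
    [M A^k k!] for its derivatives, which are read off the Puiseux series. The supposed extension
    may have poles on the segment and its expansions say nothing at their centres; hence all
    comparisons are made on punctured neighbourhoods. The point [b] must itself avoid the punctures,
    since the contradiction arises from the Laurent expansion at [b]. *)

Notation fps := (nat -> C).

Definition fadd (u v : fps) : fps := fun n => u n + v n.
Definition fopp (u : fps) : fps := fun n => - u n.
Definition fsub (u v : fps) : fps := fun n => u n - v n.
Definition fscal (c : C) (u : fps) : fps := fun n => c * u n.
Definition fcst (c : C) : fps := fun n => match n with O => c | S _ => 0 end.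
Definition fshift (u : fps) : fps :=
  fun n => match n with O => 0 | S m => u m end.
Definition fX : fps := fshift (fcst 1).

(** The Cauchy product, by structural recursion instead of a finite sum: inductions generalise over
    the left factor, and products at numeral indices evaluate by computation. *)
Fixpoint fmul (u v : fps) (n : nat) : C :=
  match n with
  | O => u O * v O
  | S m => u O * v (S m) + fmul (fun k => u (S k)) v m
  end.

Declare Scope fps_scope.
Delimit Scope fps_scope with fps.
Infix "+" := fadd : fps_scope.
Infix "-" := fsub : fps_scope.
Infix "*" := fmul : fps_scope.

Lemma fmul_addl (u v w : fps) n :
  fmul (fun k => u k + v k) w n = fmul u w n + fmul v w n.
Proof.
  revert u v; induction n as [|n IH]; intros u v; simpl; [ring|].
  rewrite (IH (fun k => u (S k)) (fun k => v (S k))); ring.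
Qed.

Lemma fmul_scall (c : C) (u w : fps) n :
  fmul (fun k => c * u k) w n = c * fmul u w n.
Proof.
  revert u; induction n as [|n IH]; intros u; simpl; [ring|].
  rewrite (IH (fun k => u (S k))); ring.
Qed.

Lemma fmul_0l (u v : fps) n : (forall k, u k = 0) -> fmul u v n = 0.
Proof.
  revert u; induction n as [|n IH]; intros u Hu; simpl; rewrite Hu; [ring|].
  rewrite IH by auto; ring.
Qed.

Lemma fmul_S (u v : fps) n :
  fmul u v (S n) = u (S n) * v O + fmul u (fun k => v (S k)) n.
Proof.
  revert u; induction n as [|n IH]; intros u; [simpl; ring|].
  change (fmul u v (S (S n)))
    with (u O * v (S (S n)) + fmul (fun k => u (S k)) v (S n)).
  rewrite IH; simpl; ring.
Qed.

Lemma fmul_comm (u v : fps) : fmul u v = fmul v u.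
Proof.
  apply functional_extensionality; intros n; revert u v.
  induction n as [|n IH]; intros u v; [simpl; ring|].
  rewrite fmul_S; simpl; rewrite IH; ring.
Qed.

Lemma fmul_assoc (u v w : fps) : fmul u (fmul v w) = fmul (fmul u v) w.
Proof.
  apply functional_extensionality; intros n; revert u.
  induction n as [|n IH]; intros u; [simpl; ring|].
  change (fmul u (fmul v w) (S n))
    with (u O * fmul v w (S n) + fmul (fun k => u (S k)) (fmul v w) n).
  change (fmul (fmul u v) w (S n))
    with (u O * v O * w (S n)
          + fmul (fun k => u O * v (S k) + fmul (fun j => u (S j)) v k) w n).
  rewrite (fmul_addl (fun k => u O * v (S k))), fmul_scall, IH.
  simpl; ring.
Qed.

(** With [fshiftE], this turns coefficientwise operations into products, so that [ring] can treat
    identities that contain scalings and shifts. *)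
Lemma fscalE c u : fscal c u = fmul (fcst c) u.
Proof.
  apply functional_extensionality; intros [|n]; [reflexivity|].
  unfold fscal; simpl; rewrite fmul_0l by reflexivity; ring.
Qed.

Lemma fshiftE u : fshift u = fmul fX u.
Proof.
  apply functional_extensionality; intros [|n]; simpl; [ring|].
  change (fun k => fX (S k)) with (fcst 1).
  rewrite <- fscalE; unfold fscal; ring.
Qed.

Lemma fps_ring_theory :
  ring_theory (fcst 0) (fcst 1) fadd fmul fsub fopp eq.
Proof.
  split; intros.
  - apply functional_extensionality; intros [|n]; unfold fadd; simpl; ring.
  - apply functional_extensionality; intros n; unfold fadd; ring.
  - apply functional_extensionality; intros n; unfold fadd; ring.
  - rewrite <- fscalE; apply functional_extensionality; intros n;
      unfold fscal; ring.
  - apply fmul_comm.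
  - apply fmul_assoc.
  - apply functional_extensionality; intros n; apply fmul_addl.
  - apply functional_extensionality; intros n; reflexivity.
  - apply functional_extensionality; intros [|n]; unfold fadd, fopp; simpl; ring.
Qed.

(** Lets [ring] compute with integer constants; the identity behind [cleared_lhs_reduced] balances
    numerals such as 120 against 40 times 3. *)
Lemma fps_ring_morph :
  ring_morph (fcst 0) (fcst 1) fadd fmul fsub fopp eq
    0%Z 1%Z Z.add Z.mul Z.sub Z.opp Z.eqb (fun z => fcst (RtoC (IZR z))).
Proof.
  split; try reflexivity; intros x y || intros x.
  - rewrite plus_IZR, RtoC_plus; apply functional_extensionality;
      intros [|n]; unfold fadd; simpl; ring.
  - rewrite minus_IZR, RtoC_minus; apply functional_extensionality;
      intros [|n]; unfold fsub; simpl; ring.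
  - rewrite mult_IZR, RtoC_mult, <- fscalE; apply functional_extensionality;
      intros [|n]; unfold fscal; simpl; ring.
  - rewrite opp_IZR, RtoC_opp; apply functional_extensionality;
      intros [|n]; unfold fopp; simpl; ring.
  - intros H; apply Z.eqb_eq in H; now rewrite H.
Qed.

Ltac fps_constant t :=
  match t with
  | fcst (RtoC (IZR ?z)) =>
      match isZcst z with
      | true => z
      | _ => constr:(InitialRing.NotConstant)
      end
  | _ => constr:(InitialRing.NotConstant)
  end.

Add Ring fps_ring : fps_ring_theory
  (morphism fps_ring_morph, constants [fps_constant]).

Lemma fcst_mul c d : fcst (c * d) = (fcst c * fcst d)%fps.
Proof.
  rewrite <- fscalE; apply functional_extensionality; intros [|n];
    unfold fscal; simpl; ring.
Qed.

Lemma sum_n_fmul (u v : fps) n :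
  sum_n (G := C_AbelianMonoid) (fun i => u i * v (n - i)%nat) n = fmul u v n.
Proof.
  revert u; induction n as [|n IH]; intros u.
  - rewrite sum_O; reflexivity.
  - unfold sum_n; rewrite sum_Sn_m by lia.
    rewrite <- sum_n_m_S; simpl; rewrite <- IH; reflexivity.
Qed.

(** * Reduction of the equation *)

Definition fshiftn (k : nat) (u : fps) : fps := Nat.iter k fshift u.

Lemma fshiftn_lt k u m : (m < k)%nat -> fshiftn k u m = 0.
Proof.
  revert m; induction k as [|k IH]; intros m Hm; [lia|].
  destruct m as [|m]; [reflexivity|]; apply IH; lia.
Qed.

Lemma fshiftn_add k u m : fshiftn k u (k + m)%nat = u m.
Proof. induction k as [|k IH]; [reflexivity|exact IH]. Qed.

(* [tder k a] lists the coefficients of [(t - b)^k] times the [k]-th derivative of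
   [sum_n a_n (t - b)^(n/3)]. *)
Fixpoint ffact (k : nat) (x : R) : R :=
  match k with O => 1 | S j => (ffact j x * (x - INR j))%R end.
Definition tder (k : nat) (a : fps) : fps :=
  fun n => RtoC (ffact k (INR n / 3)%R) * a n.

(* [formal_lhs] times [(t - b)^5], as a power series in [(t - b)^(1/3)]. *)
Definition cleared_lhs (b : C) (a : fps) : fps :=
  (fshiftn 3 (tder 4 a)
   + fcst 120 * (tder 1 a * tder 1 a * tder 1 a * tder 2 a)
   + fcst (- (120)) * fshiftn 6 (tder 1 a * tder 2 a
                                 * (fcst b + fshiftn 3 (fcst 1)))
   + fcst (- (200 / 3)) * fshiftn 9 (tder 1 a * tder 1 a)
   + fcst (- (40 / 3)) * fshiftn 9 (a * tder 2 a)
   + fcst (200 / 9) * fshiftn 15 (fcst b + fshiftn 3 (fcst 1)))%fps.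

Lemma coefficient_padd f g j :
  coefficient (padd f g) j = coefficient f j + coefficient g j.
Proof.
  unfold coefficient at 1; simpl.
  destruct (Z_lt_dec j (Z.min (pord f) (pord g))) as [H|H].
  - unfold coefficient; destruct Z_lt_dec; [|lia]; destruct Z_lt_dec; [|lia].
    ring.
  - now rewrite Z2Nat.id, Zplus_minus by lia.
Qed.

Lemma coefficient_pscal c f j :
  coefficient (pscal c f) j = c * coefficient f j.
Proof.
  unfold coefficient; simpl; destruct Z_lt_dec; [ring|reflexivity].
Qed.

Lemma coefficient_fshiftn (f : puiseux) (k N m : nat) :
  pord f = (Z.of_nat k - Z.of_nat N)%Z ->
  coefficient f (Z.of_nat m - Z.of_nat N)%Z = fshiftn k (pcoef f) m.
Proof.
  intros Hf; unfold coefficient; rewrite Hf.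
  destruct Z_lt_dec; [now rewrite fshiftn_lt by lia|].
  replace m with (k + (m - k))%nat at 2 by lia.
  rewrite fshiftn_add; f_equal; lia.
Qed.

Lemma pmul_fmul f g :
  pmul f g = Puiseux (pord f + pord g) (fmul (pcoef f) (pcoef g)).
Proof.
  unfold pmul; f_equal; apply functional_extensionality; intros n.
  apply sum_n_fmul.
Qed.

Lemma pvar_fps b : pvar b = Puiseux 0 (fcst b + fshiftn 3 (fcst 1))%fps.
Proof.
  unfold pvar; f_equal; apply functional_extensionality.
  intros [|[|[|[|n]]]]; unfold fadd; simpl; ring.
Qed.

Lemma formal_lhs_cleared b a m :
  coefficient (formal_lhs b a) (Z.of_nat m - 15)%Z = cleared_lhs b a m.
Proof.
  assert (D1 : forall a0, pderiv (Puiseux 0 a0) = Puiseux (-3) (tder 1 a0)).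
  { intros a0; unfold pderiv, tder; f_equal; apply functional_extensionality.
    intros n; cbn [pcoef]; cbn [pord]; f_equal; f_equal; simpl.
    rewrite <- INR_IZR_INZ; field. }
  assert (D2 : forall k a0, pderiv (Puiseux (- (3 * Z.of_nat k)) (tder k a0))
                  = Puiseux (- (3 * Z.of_nat (S k))) (tder (S k) a0)).
  { intros k a0; unfold pderiv, tder; f_equal; [cbn [pord]; lia|].
    apply functional_extensionality; intros n; cbn [pcoef]; cbn [pord].
    rewrite Cmult_assoc, <- RtoC_mult; f_equal; f_equal.
    cbn [ffact]; rewrite plus_IZR, opp_IZR, mult_IZR, <- !INR_IZR_INZ.
    field. }
  unfold formal_lhs; rewrite D1.
  change (-3)%Z with (- (3 * Z.of_nat 1))%Z; rewrite !D2.
  rewrite pvar_fps, !pmul_fmul, !coefficient_padd, !coefficient_pscal.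
  change 15%Z with (Z.of_nat 15).
  (* The six terms start at the orders -12, -15, -9, -6, -6 and 0; each shift is this order plus
     15. *)
  rewrite (coefficient_fshiftn _ 3), (coefficient_fshiftn _ 0),
    (coefficient_fshiftn _ 6), (coefficient_fshiftn _ 9),
    (coefficient_fshiftn _ 9), (coefficient_fshiftn _ 15) by reflexivity.
  unfold cleared_lhs, fadd at 1 2 3 4 5; rewrite <- !fscalE; reflexivity.
Qed.

Lemma formal_solution_cleared b a :
  cleared_lhs b a = fcst 0 -> formal_solution b a.
Proof.
  intros H j; destruct (Z_lt_dec j (-15)) as [Hj|Hj].
  - unfold coefficient; destruct Z_lt_dec as [|Hn]; [reflexivity|].
    exfalso; apply Hn.
    replace (pord (formal_lhs b a)) with (-15)%Z by reflexivity; exact Hj.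
  - replace j with (Z.of_nat (Z.to_nat (j + 15)) - 15)%Z by lia.
    rewrite formal_lhs_cleared, H; now destruct Z.to_nat.
Qed.

Definition wt (f : nat -> Z) (e : fps) : fps := fun n => RtoC (IZR (f n)) * e n.

(* With [e_n = a_(n+5)], the weights [wP] and [wQ] are [3] and [9] times those of
   the first two derivatives; [wL] is the resonance polynomial. *)
Definition wP (n : nat) : Z := (Z.of_nat n + 5)%Z.
Definition wQ (n : nat) : Z := ((Z.of_nat n + 5) * (Z.of_nat n + 2))%Z.
Definition wL (n : nat) : Z :=
  ((Z.of_nat n + 5) * (Z.of_nat n + 7) * (Z.of_nat n - 4) * (Z.of_nat n - 6))%Z.

(** The nested form, here and in [inhom], allows norms to be bounded by repeating a single estimate
    for [fcst c + fshiftn j u]. *)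
Definition series_of (a0 : C) (e : fps) : fps :=
  (fcst a0 + fshift (fcst (-1) + fshiftn 4 e))%fps.

(** The polynomial [A0]. The normalisation is such that the cleared equation equals [w^8 / 81] times
    the sum of [wt wL e], [inhom] and [w^4] times [interaction]. *)
Definition inhom (b a0 : C) : fps :=
  (fcst (720 * b) + fshiftn 2 (fcst (- (240) * a0)
   + fshift (fcst 360 + fshiftn 4 (fcst (1800 * b) + fshiftn 3 (fcst 1800)))))%fps.

Definition interaction (b a0 : C) (e : fps) : fps :=
  let P := wt wP e in
  let Q := wt wQ e in
  (fscal 120 (P * (Q - fscal 2 P))
   + fshiftn 4 (fscal 40 (P * P * (fscal 2 P - fscal 3 Q))
                + fshiftn 4 (fscal 40 (P * P * P * Q)))
   - (fscal (360 * b) (fscal 2 P - Q + fshiftn 4 (P * Q))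
      + fshiftn 3 (fscal 360 (fscal 2 P - Q + fshiftn 4 (P * Q))))
   - fshiftn 3 (fscal 600 (fshiftn 4 (P * P) - fscal 2 P))
   - fshiftn 2 (fscal (120 * a0) Q
                + fshift (fscal 120 (fscal 2 e - Q + fshiftn 4 (e * Q)))))%fps.

Lemma cleared_lhs_reduced b a0 e :
  (wt wL e + inhom b a0 + fshiftn 4 (interaction b a0 e))%fps = fcst 0 ->
  cleared_lhs b (series_of a0 e) = fcst 0.
Proof.
  intros He.
  (* All denominators are powers of 3. They are carried by an abstract constant [K] with [3 K = 1],
     which leaves an identity between polynomials with integer coefficients. *)
  pose (K := fcst (/ 3)).
  assert (HK : (fcst 3 * K)%fps = fcst 1).
  { unfold K; rewrite <- fcst_mul; f_equal; field. }
  pose (G := wt (fun n => (Z.of_nat n + 5) * (Z.of_nat n + 2)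
                          * (Z.of_nat n - 1) * (Z.of_nat n - 4))%Z e).
  pose (P := wt wP e); pose (Q := wt wQ e).
  assert (D1 : tder 1 (series_of a0 e)
               = (fshift (K * (fcst (-1) + fshiftn 4 P)))%fps).
  { unfold K; rewrite <- fscalE.
    apply functional_extensionality; unfold tder, series_of, fadd, fscal.
    intros [|[|[|[|[|n]]]]]; cbn [fshift fshiftn Nat.iter nat_rect fcst ffact];
    rewrite ?S_INR; change (INR 0) with 0%R;
    rewrite ?RtoC_mult, ?RtoC_minus, ?RtoC_div, ?RtoC_plus by lra; try field.
    unfold P, wt, wP. rewrite plus_IZR, <- INR_IZR_INZ.
    rewrite ?RtoC_mult, ?RtoC_minus, ?RtoC_plus; field. }
  assert (D2 : tder 2 (series_of a0 e)
               = (fshift (K * K * (fcst 2 + fshiftn 4 Q)))%fps).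
  { unfold K; rewrite <- fcst_mul, <- fscalE.
    apply functional_extensionality; unfold tder, series_of, fadd, fscal.
    intros [|[|[|[|[|n]]]]]; cbn [fshift fshiftn Nat.iter nat_rect fcst ffact];
    rewrite ?S_INR; change (INR 0) with 0%R;
    rewrite ?RtoC_mult, ?RtoC_minus, ?RtoC_div, ?RtoC_plus by lra; try field.
    unfold Q, wt, wQ. rewrite mult_IZR, !plus_IZR, <- INR_IZR_INZ.
    rewrite ?RtoC_mult, ?RtoC_minus, ?RtoC_plus; field. }
  assert (D4 : tder 4 (series_of a0 e)
               = (fshift (K * K * K * K * (fcst 80 + fshiftn 4 G)))%fps).
  { unfold K; rewrite <- !fcst_mul, <- fscalE.
    apply functional_extensionality; unfold tder, series_of, fadd, fscal.
    intros [|[|[|[|[|n]]]]]; cbn [fshift fshiftn Nat.iter nat_rect fcst ffact];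
    rewrite ?S_INR; change (INR 0) with 0%R;
    rewrite ?RtoC_mult, ?RtoC_minus, ?RtoC_div, ?RtoC_plus by lra; try field.
    unfold G, wt; cbv beta.
    rewrite !mult_IZR, !minus_IZR, !plus_IZR, <- INR_IZR_INZ.
    rewrite ?RtoC_mult, ?RtoC_minus, ?RtoC_plus; field. }
  (* The resonance polynomial is the weight [G] of the fourth derivative plus the linear part of
     [40 (-1 + P)^3 (2 + Q)], which is [240 P - 40 Q]. *)
  assert (HL : wt wL e = (G + fscal 240 P - fscal 40 Q)%fps).
  { apply functional_extensionality; intros n.
    unfold fsub, fadd, fscal, G, P, Q, wt, wL, wP, wQ; cbv beta.
    rewrite !mult_IZR, !minus_IZR, !plus_IZR.
    rewrite !RtoC_mult, !RtoC_minus, !RtoC_plus; ring. }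
  assert (C3 : fcst (- (200 / 3)) = (fcst (-200) * K)%fps)
    by (unfold K; rewrite <- fcst_mul; f_equal; field).
  assert (C4 : fcst (- (40 / 3)) = (fcst (-40) * K)%fps)
    by (unfold K; rewrite <- fcst_mul; f_equal; field).
  assert (C5 : fcst (200 / 9) = (fcst 200 * K * K)%fps)
    by (unfold K; rewrite <- !fcst_mul; f_equal; field).
  assert (C2 : fcst (- (120)) = fcst (-120)) by (f_equal; ring).
  unfold cleared_lhs; rewrite D1, D2, D4, C2, C3, C4, C5.
  rewrite HL in He; revert He.
  unfold inhom, interaction, series_of; fold P Q.
  replace (- (240) * a0) with (-240 * a0) by ring.
  rewrite !fscalE, !fcst_mul; cbn [fshiftn Nat.iter nat_rect]; rewrite !fshiftE.
  clearbody K G P Q; clear D1 D2 D4 HL C2 C3 C4 C5.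
  set (B := fcst b); set (A := fcst a0); intros He.
  (* The two sides agree modulo [3 K = 1]: [o1 = 1], [o2 = 3 K] gives a multiple
     of the left-hand side of [He]. *)
  pose (F := fun o1 o2 : fps =>
   (fX * fX * fX * fX * K * K * K *
    (K * (fcst 80 + fX * (fX * (fX * (fX * G))))
     + fcst 40 * o1 * K * (fcst (-1) + fX * (fX * (fX * (fX * P))))
       * (fcst (-1) + fX * (fX * (fX * (fX * P))))
       * (fcst (-1) + fX * (fX * (fX * (fX * P))))
       * (fcst 2 + fX * (fX * (fX * (fX * Q))))
     - fcst 120 * o2 * fX * fX * fX * fX
       * (B + fX * fX * fX) * (fcst (-1) + fX * (fX * (fX * (fX * P))))
       * (fcst 2 + fX * (fX * (fX * (fX * Q))))
     - fcst 200 * o2 * fX * fX * fX * fX * fX * fX * fX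
       * (fcst (-1) + fX * (fX * (fX * (fX * P))))
       * (fcst (-1) + fX * (fX * (fX * (fX * P))))
     - fcst 40 * o2 * fX * fX * fX * fX * fX * fX
       * (A + fX * (fcst (-1) + fX * (fX * (fX * (fX * e)))))
       * (fcst 2 + fX * (fX * (fX * (fX * Q)))))
     + fcst 200 * K * K * o2 * o2 * fX * fX * fX * fX * fX * fX * fX * fX
       * fX * fX * fX * fX * fX * fX * fX * (B + fX * fX * fX))%fps).
  transitivity (F (fcst 3 * K)%fps (fcst 1)).
  { unfold F; ring. }
  rewrite HK; pattern (fcst 1) at 2; rewrite <- HK.
  match type of He with ?L = _ =>
    transitivity (fX * fX * fX * fX * fX * fX * fX * fX * K * K * K * K * L)%fps
  end.
  { unfold F; ring. }
  rewrite He; ring.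
Qed.

(** * Recursive solution *)

Definition agree (n : nat) (u v : fps) := forall k, (k <= n)%nat -> u k = v k.

Lemma agree_le m n u v : (m <= n)%nat -> agree n u v -> agree m u v.
Proof. intros Hm H k Hk; apply H; lia. Qed.

Lemma agree_fmul n u u' v v' :
  agree n u u' -> agree n v v' -> agree n (u * v)%fps (u' * v')%fps.
Proof.
  intros Hu Hv k Hk.
  assert (Hu' := agree_le _ _ _ _ Hk Hu); assert (Hv' := agree_le _ _ _ _ Hk Hv).
  clear Hu Hv Hk n; revert u u' Hu'.
  induction k as [|k IH]; intros u u' Hu'; simpl.
  - now rewrite (Hu' 0%nat), (Hv' 0%nat).
  - rewrite (Hu' 0%nat), (Hv' (S k)) by lia; f_equal; apply IH.
    + intros j Hj; apply Hv'; lia.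
    + intros j Hj; apply Hu'; lia.
Qed.

Lemma agree_fshiftn n j u v :
  agree n u v -> agree n (fshiftn j u) (fshiftn j v).
Proof.
  intros H k Hk; destruct (Nat.lt_ge_cases k j).
  - now rewrite !fshiftn_lt.
  - replace k with (j + (k - j))%nat by lia; rewrite !fshiftn_add; apply H; lia.
Qed.

(** Sums, products and shifts are causal. After the further shift by 4, the equation of index [n]
    therefore involves only [e_k] with [k <= n - 4], apart from its linear term. *)
Lemma interaction_agree b a0 e e' n :
  agree n e e' -> agree n (interaction b a0 e) (interaction b a0 e').
Proof.
  intros H.
  assert (HP : agree n (wt wP e) (wt wP e'))
    by (intros k Hk; unfold wt; now rewrite H).
  assert (HQ : agree n (wt wQ e) (wt wQ e'))
    by (intros k Hk; unfold wt; now rewrite H).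
  assert (Hadd : forall u u' v v', agree n u u' -> agree n v v' ->
                   agree n (u + v)%fps (u' + v')%fps)
    by (intros u u' v v' Hu Hv k Hk; unfold fadd; now rewrite Hu, Hv).
  assert (Hsub : forall u u' v v', agree n u u' -> agree n v v' ->
                   agree n (u - v)%fps (u' - v')%fps)
    by (intros u u' v v' Hu Hv k Hk; unfold fsub; now rewrite Hu, Hv).
  assert (Hscal : forall c u u', agree n u u' -> agree n (fscal c u) (fscal c u'))
    by (intros c u u' Hu k Hk; unfold fscal; now rewrite Hu).
  unfold interaction; change fshift with (fshiftn 1).
  repeat first [ apply Hsub | apply Hadd | apply Hscal | apply agree_fshiftn
               | apply agree_fmul | assumption ].
Qed.

(** Course-of-values recursion: the [n]-th iterate of [step], started at the zero sequence, no
    longer changes at indices below [n]. *)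
Lemma recursive_sequence (step : fps -> nat -> C) :
  (forall n e e', (forall k, (k < n)%nat -> e k = e' k) -> step e n = step e' n) ->
  exists e : fps, forall n, e n = step e n.
Proof.
  intros Hstep.
  pose (E := fun n => Nat.iter n step (fun _ => 0)).
  assert (HE : forall n k, (k < n)%nat -> E n k = E (S n) k).
  { induction n as [|n IH]; intros k Hk; [lia|].
    apply (Hstep k (E n) (E (S n))); intros j Hj; apply IH; lia. }
  assert (HE' : forall d k, E (S k + d)%nat k = E (S k) k).
  { induction d as [|d IH]; intros k; [now rewrite Nat.add_0_r|].
    rewrite Nat.add_succ_r, <- HE by lia; apply IH. }
  exists (fun k => E (S k) k); intros n.
  apply (Hstep n (E n)); intros k Hk.
  rewrite <- (HE' (n - S k)%nat k); f_equal; lia.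
Qed.

Definition solution_step (b a0 a9 a11 : C) (e : fps) (n : nat) : C :=
  if Nat.eq_dec n 4 then a9 else if Nat.eq_dec n 6 then a11 else
  - (inhom b a0 n + fshiftn 4 (interaction b a0 e) n) / RtoC (IZR (wL n)).

Lemma solution_coefficients (b a0 a9 a11 : C) :
  exists e : fps,
    (forall n, e n = solution_step b a0 a9 a11 e n) /\
    (wt wL e + inhom b a0 + fshiftn 4 (interaction b a0 e))%fps = fcst 0 /\
    e 0%nat = - (6 / 7) * b /\ e 1%nat = 0 /\ e 2%nat = 10 / 21 * a0 /\
    e 3%nat = - (3 / 2) /\ e 4%nat = a9 /\ e 5%nat = 0 /\ e 6%nat = a11 /\
    e 7%nat = - (135 / 49) * b.
Proof.
  destruct (recursive_sequence (solution_step b a0 a9 a11)) as [e He].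
  { intros n e e' H; unfold solution_step.
    destruct (Nat.eq_dec n 4); [reflexivity|].
    destruct (Nat.eq_dec n 6); [reflexivity|].
    destruct (Nat.lt_ge_cases n 4); [now rewrite !fshiftn_lt|].
    replace n with (4 + (n - 4))%nat by lia; rewrite !fshiftn_add.
    rewrite (interaction_agree b a0 e e' (n - 4)); [reflexivity| |lia].
    intros k Hk; apply H; lia. }
  exists e; split; [exact He|].
  assert (E0 : e 0%nat = - (6 / 7) * b).
  { rewrite He; unfold solution_step; cbn -[interaction].
    unfold inhom, fadd; cbn -[interaction]; field. }
  assert (E1 : e 1%nat = 0).
  { rewrite He; unfold solution_step; cbn -[interaction].
    unfold inhom, fadd; cbn -[interaction]; field. }
  assert (E2 : e 2%nat = 10 / 21 * a0).
  { rewrite He; unfold solution_step; cbn -[interaction].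
    unfold inhom, fadd; cbn -[interaction]; field. }
  assert (E3 : e 3%nat = - (3 / 2)).
  { rewrite He; unfold solution_step; cbn -[interaction].
    unfold inhom, fadd; cbn -[interaction]; field. }
  (* As [inhom] has no coefficient of index 4 or 6, [M0] and [M2] are the compatibility conditions
     at the two resonances. [M0] rests on [wQ 0 = 2 wP 0], whereas [M2] depends on a cancellation
     between the values of [e 0] and [e 2]. [M1] and [M3] serve to compute [e 5] and [e 7]. *)
  assert (M0 : interaction b a0 e 0 = 0).
  { unfold interaction, fadd, fsub, fscal, wt, wP, wQ; cbn; rewrite E0; field. }
  assert (M1 : interaction b a0 e 1 = 0).
  { unfold interaction, fadd, fsub, fscal, wt, wP, wQ; cbn; rewrite E0, E1; field. }
  assert (M2 : interaction b a0 e 2 = 0).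
  { unfold interaction, fadd, fsub, fscal, wt, wP, wQ; cbn;
      rewrite E0, E1, E2; field. }
  assert (M3 : interaction b a0 e 3
    = - (2880 / 7) * b).
  { unfold interaction, fadd, fsub, fscal, wt, wP, wQ; cbn;
      rewrite E0, E1, E2, E3. field. }
  assert (E4 : e 4%nat = a9) by (now rewrite He).
  assert (E6 : e 6%nat = a11) by (now rewrite He).
  assert (E5 : e 5%nat = 0).
  { rewrite He; unfold solution_step; cbn -[interaction]; rewrite M1.
    unfold inhom, fadd; cbn -[interaction]; field. }
  assert (E7 : e 7%nat = - (135 / 49) * b).
  { rewrite He; unfold solution_step; cbn -[interaction]; rewrite M3.
    unfold inhom, fadd; cbn -[interaction]; field. }
  split; [|repeat split; assumption].
  apply functional_extensionality; intros n.
  replace (fcst 0 n) with (RtoC 0) by (now destruct n).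
  unfold fadd at 1 2; unfold wt at 1.
  destruct (Nat.eq_dec n 4) as [->|H4].
  { change (fshiftn 4 (interaction b a0 e) 4) with (interaction b a0 e 0).
    rewrite M0; unfold inhom, fadd; cbn; ring. }
  destruct (Nat.eq_dec n 6) as [->|H6].
  { change (fshiftn 4 (interaction b a0 e) 6) with (interaction b a0 e 2).
    rewrite M2; unfold inhom, fadd; cbn; ring. }
  rewrite He; unfold solution_step.
  destruct (Nat.eq_dec n 4); [easy|]; destruct (Nat.eq_dec n 6); [easy|].
  field; intros HL; apply RtoC_inj, eq_IZR in HL; unfold wL in HL.
  repeat (apply Z.mul_eq_0 in HL; destruct HL as [HL|HL]); lia.
Qed.

Lemma formal_solution_exists (b a0 a9 a11 : C) :
  exists a : nat -> C,
    formal_solution b a /\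
    a 0%nat = a0 /\ a 1%nat = - (1) /\ a 2%nat = 0 /\ a 3%nat = 0 /\
    a 4%nat = 0 /\ a 5%nat = - (6 / 7) * b /\ a 6%nat = 0 /\
    a 7%nat = 10 / 21 * a0 /\ a 8%nat = - (3 / 2) /\ a 9%nat = a9 /\
    a 10%nat = 0 /\ a 11%nat = a11 /\ a 12%nat = - (135 / 49) * b.
Proof.
  destruct (solution_coefficients b a0 a9 a11) as (e & _ & He & HE).
  exists (series_of a0 e).
  split; [now apply formal_solution_cleared, cleared_lhs_reduced|].
  destruct HE as (E0 & E1 & E2 & E3 & E4 & E5 & E6 & E7).
  unfold series_of, fadd; cbn.
  rewrite E0, E1, E2, E3, E4, E5, E6, E7; repeat split; ring.
Qed.

(** * Convergence *)

(* [fnorm r u K] is [sum_(n <= K) |u_n| r^n]. *)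
Fixpoint fnorm (r : R) (u : fps) (K : nat) : R :=
  match K with
  | O => Cmod (u O)
  | S k => (Cmod (u O) + r * fnorm r (fun j => u (S j)) k)%R
  end.

Section Norm.
Local Open Scope R_scope.
Variable r : R.
Hypothesis r_pos : 0 <= r.

Lemma fnorm_ge0 u K : 0 <= fnorm r u K.
Proof.
  revert u; induction K as [|K IH]; intros u; simpl; [apply Cmod_ge_0|].
  generalize (Cmod_ge_0 (u O)) (IH (fun j => u (S j))); nra.
Qed.

Lemma fnorm_S u K : fnorm r u K <= fnorm r u (S K).
Proof.
  revert u; induction K as [|K IH]; intros u.
  - simpl; generalize (Cmod_ge_0 (u 1%nat)); nra.
  - change (Cmod (u O) + r * fnorm r (fun j => u (S j)) K
            <= Cmod (u O) + r * fnorm r (fun j => u (S j)) (S K)).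
    generalize (IH (fun j => u (S j))); nra.
Qed.

Lemma fnorm_dom c u v K :
  (forall n, Cmod (u n) <= c * Cmod (v n)) -> fnorm r u K <= c * fnorm r v K.
Proof.
  revert u v; induction K as [|K IH]; intros u v H; simpl; [apply H|].
  generalize (H O) (IH (fun j => u (S j)) (fun j => v (S j)) (fun n => H (S n))).
  nra.
Qed.

Lemma fnorm_add u v K : fnorm r (u + v)%fps K <= fnorm r u K + fnorm r v K.
Proof.
  revert u v; induction K as [|K IH]; intros u v; simpl.
  - apply Cmod_triangle.
  - generalize (Cmod_triangle (u O) (v O))
      (IH (fun j => u (S j)) (fun j => v (S j))).
    unfold fadd; nra.
Qed.

Lemma fnorm_sub u v K : fnorm r (u - v)%fps K <= fnorm r u K + fnorm r v K.
Proof.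
  replace (u - v)%fps with (u + fopp v)%fps by reflexivity.
  eapply Rle_trans; [apply fnorm_add|apply Rplus_le_compat_l].
  rewrite <- (Rmult_1_l (fnorm r v K)); apply fnorm_dom.
  intros n; unfold fopp; rewrite Cmod_opp; lra.
Qed.

Lemma fnorm_scal c u K : fnorm r (fscal c u) K <= Cmod c * fnorm r u K.
Proof. apply fnorm_dom; intros n; unfold fscal; rewrite Cmod_mult; lra. Qed.

(** The truncated product omits only non-negative contributions of degree above [K]. In the
    induction the tail of [u] meets [v] truncated at [K], and [fnorm_S] compares this with the
    truncation at [K + 1]. *)
Lemma fnorm_mul u v K : fnorm r (u * v)%fps K <= fnorm r u K * fnorm r v K.
Proof.
  revert u; induction K as [|K IH]; intros u; simpl.
  - rewrite Cmod_mult; lra.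
  - rewrite Cmod_mult.
    assert (H := fnorm_add (fscal (u O) (fun j => v (S j)))
                   (fmul (fun j => u (S j)) v) K).
    generalize (fnorm_scal (u O) (fun j => v (S j)) K) (IH (fun j => u (S j)))
      (fnorm_S v K) (fnorm_ge0 (fun j => u (S j)) K) (Cmod_ge_0 (u O)).
    change (fnorm r v (S K))
      with (Cmod (v O) + r * fnorm r (fun j => v (S j)) K).
    change (fun j : nat => u O * v (S j) + fmul (fun k => u (S k)) v j)%C
      with (fscal (u O) (fun j => v (S j)) + fmul (fun j => u (S j)) v)%fps.
    set (x := fnorm r (fadd _ _) K) in *; set (y := fnorm r (fscal _ _) K) in *.
    set (z := fnorm r (fmul _ _) K) in *.
    set (U := fnorm r (fun j => u (S j)) K);
      set (V := fnorm r (fun j => v (S j)) K); set (W := fnorm r v K).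
    intros H1 H2 H3 H4 H5.
    assert (U * W <= U * (Cmod (v O) + r * V)) by (now apply Rmult_le_compat_l).
    assert (r * x <= r * (Cmod (u O) * V + U * (Cmod (v O) + r * V)))
      by (apply Rmult_le_compat_l; lra).
    nra.
Qed.

Lemma fnorm_cst c K : fnorm r (fcst c) K = Cmod c.
Proof.
  assert (H0 : forall k, fnorm r (fun _ => RtoC 0) k = 0).
  { induction k as [|k IH]; simpl; rewrite ?IH, Cmod_0; ring. }
  destruct K as [|K]; [reflexivity|].
  simpl; rewrite H0; ring.
Qed.

Lemma fnorm_fshift u K : fnorm r (fshift u) (S K) = r * fnorm r u K.
Proof.
  simpl; rewrite Cmod_0, Rplus_0_l; reflexivity.
Qed.

Lemma fnorm_term u K : Cmod (u K) * r ^ K <= fnorm r u K.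
Proof.
  revert u; induction K as [|K IH]; intros u; simpl; [lra|].
  generalize (IH (fun j => u (S j))) (Cmod_ge_0 (u O)); nra.
Qed.

Hypothesis r_le1 : r <= 1.

Lemma fnorm_fshiftn k u K : fnorm r (fshiftn k u) K <= fnorm r u K.
Proof.
  revert K; induction k as [|k IH]; intros K; [apply Rle_refl|].
  change (fshiftn (S k) u) with (fshift (fshiftn k u)); destruct K as [|K].
  - simpl; rewrite Cmod_0; apply Cmod_ge_0.
  - rewrite fnorm_fshift; generalize (IH K) (fnorm_S u K) (fnorm_ge0 u K); nra.
Qed.

End Norm.

(** This weight dominates 1, [wP] and [wQ], and off the resonances it is dominated by [|wL|]. One
    weighted sum thus controls every factor of [interaction] and is in turn controlled by the
    recursion. *)
Definition wS (n : nat) : Z := ((Z.of_nat n + 5) * (Z.of_nat n + 5))%Z.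

Lemma Cmod_wt f e n : Cmod (wt f e n) = (IZR (Z.abs (f n)) * Cmod (e n))%R.
Proof. unfold wt; now rewrite Cmod_mult, Cmod_R, abs_IZR. Qed.

(** Obtained from [interaction] by replacing each of [e], [P], [Q] by [s], constants by their moduli
    and differences by sums, and dropping the shifts. *)
Definition interaction_bound (b a0 : C) (s : R) : R :=
  (120 * (s * (s + 2 * s)) + 40 * (s * s * (2 * s + 3 * s))
   + 40 * (s * s * s * s)
   + 360 * Cmod b * (2 * s + s + s * s) + 360 * (2 * s + s + s * s)
   + 600 * (s * s + 2 * s) + 120 * Cmod a0 * s + 120 * (2 * s + s + s * s))%R.

Lemma fnorm_interaction b a0 e r s K :
  (0 <= r <= 1)%R -> (fnorm r (wt wS e) K <= s)%R ->
  (fnorm r (interaction b a0 e) K <= interaction_bound b a0 s)%R.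
Proof.
  intros [Hr Hr1] Hs.
  assert (Hdom : forall f, (forall n, Z.abs (f n) <= wS n)%Z ->
                   (fnorm r (wt f e) K <= s)%R).
  { intros f Hf; eapply Rle_trans; [|exact Hs].
    rewrite <- (Rmult_1_l (fnorm r (wt wS e) K)).
    apply fnorm_dom; [easy|]; intros n; rewrite Rmult_1_l, !Cmod_wt.
    apply Rmult_le_compat_r; [apply Cmod_ge_0|apply IZR_le].
    specialize (Hf n); lia. }
  assert (HP : (fnorm r (wt wP e) K <= s)%R) by
    (apply Hdom; intros n; unfold wP, wQ, wS; nia).
  assert (HQ : (fnorm r (wt wQ e) K <= s)%R) by
    (apply Hdom; intros n; unfold wP, wQ, wS; nia).
  assert (He : (fnorm r e K <= s)%R).
  { replace e with (wt (fun _ => 1%Z) e)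
      by (apply functional_extensionality; intros n; unfold wt; ring).
    apply Hdom; intros n; unfold wS; nia. }
  assert (Hadd : forall u v x y, (fnorm r u K <= x)%R -> (fnorm r v K <= y)%R ->
                   (fnorm r (u + v)%fps K <= x + y)%R)
    by (intros u v x y Hu Hv; generalize (fnorm_add r Hr u v K); lra).
  assert (Hsub : forall u v x y, (fnorm r u K <= x)%R -> (fnorm r v K <= y)%R ->
                   (fnorm r (u - v)%fps K <= x + y)%R)
    by (intros u v x y Hu Hv; generalize (fnorm_sub r Hr u v K); lra).
  assert (Hmul : forall u v x y, (fnorm r u K <= x)%R -> (fnorm r v K <= y)%R ->
                   (fnorm r (u * v)%fps K <= x * y)%R).
  { intros u v x y Hu Hv; eapply Rle_trans; [now apply fnorm_mul|].
    apply Rmult_le_compat; auto using fnorm_ge0. }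
  assert (Hscal : forall c u x, (fnorm r u K <= x)%R ->
                   (fnorm r (fscal c u) K <= Cmod c * x)%R).
  { intros c u x Hu; eapply Rle_trans; [now apply fnorm_scal|].
    apply Rmult_le_compat_l; [apply Cmod_ge_0|easy]. }
  assert (Hshift : forall k u x, (fnorm r u K <= x)%R ->
                   (fnorm r (fshiftn k u) K <= x)%R)
    by (intros k u x Hu; generalize (fnorm_fshiftn r Hr Hr1 k u K); lra).
  assert (HC : forall z, (0 <= z)%Z -> Cmod (RtoC (IZR z)) = IZR z).
  { intros z Hz; rewrite Cmod_R, Rabs_pos_eq; [easy|now apply IZR_le]. }
  (* The intermediate bound is an existential variable, filled in by the rules above along the
     syntax of [interaction]. *)
  eapply Rle_trans.
  { unfold interaction; change fshift with (fshiftn 1).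
    repeat first [ eassumption | eapply Hsub | eapply Hadd | eapply Hscal
                 | eapply Hshift | eapply Hmul ]. }
  rewrite !Cmod_mult, !HC by lia.
  unfold interaction_bound; lra.
Qed.

(** Off the resonances [|n - 4|] and [|n - 6|] are at least 1, so that division by [wL] absorbs
    [wS]. At the resonances the free parameters carry the weights [81 = wS 4] and [121 = wS 6]. *)
Lemma solution_step_bound b a0 a9 a11 e n :
  e n = solution_step b a0 a9 a11 e n ->
  (Cmod (wt wS e n)
   <= Cmod (inhom b a0 n) + Cmod (fshiftn 4 (interaction b a0 e) n)
      + Cmod (fshiftn 4 (fcst (81 * a9) + fshiftn 2 (fcst (121 * a11)))%fps n))%R.
Proof.
  unfold solution_step; destruct (Nat.eq_dec n 4) as [->|H4].
  { intros He; unfold wt; rewrite He; unfold fadd; cbn.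
    rewrite Cplus_0_r; generalize (Cmod_ge_0 (inhom b a0 4)).
    generalize (Cmod_ge_0 (interaction b a0 e 0)); unfold inhom, fadd; cbn; lra. }
  destruct (Nat.eq_dec n 6) as [->|H6].
  { intros He; unfold wt; rewrite He; unfold fadd; cbn.
    rewrite Cplus_0_l; generalize (Cmod_ge_0 (inhom b a0 6)).
    generalize (Cmod_ge_0 (interaction b a0 e 2)); unfold inhom, fadd; cbn; lra. }
  intros He.
  assert (HL : (wS n <= Z.abs (wL n))%Z /\ (0 < Z.abs (wL n))%Z).
  { unfold wL, wS; rewrite !Z.abs_mul.
    rewrite (Z.abs_eq (Z.of_nat n + 5)), (Z.abs_eq (Z.of_nat n + 7)) by lia.
    assert (1 <= Z.abs (Z.of_nat n - 4))%Z by lia.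
    assert (1 <= Z.abs (Z.of_nat n - 6))%Z by lia.
    set (x := Z.abs (Z.of_nat n - 4)) in *; set (y := Z.abs (Z.of_nat n - 6)) in *.
    assert (1 <= x * y)%Z by nia.
    rewrite <- Z.mul_assoc.
    assert ((Z.of_nat n + 5) * (Z.of_nat n + 7) * 1
            <= (Z.of_nat n + 5) * (Z.of_nat n + 7) * (x * y))%Z
      by (apply Z.mul_le_mono_nonneg_l; nia).
    nia. }
  destruct HL as [HL HL0].
  rewrite Cmod_wt, He, Cmod_div.
  2:{ intros H; apply RtoC_inj, eq_IZR in H; lia. }
  rewrite Cmod_opp, Cmod_R, <- abs_IZR.
  assert (HS : (0 <= wS n)%Z) by (unfold wS; nia).
  rewrite (Z.abs_eq (wS n)) by easy.
  apply IZR_le in HL, HS; apply IZR_lt in HL0.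
  set (N := (inhom b a0 n + fshiftn 4 (interaction b a0 e) n)).
  assert (HN := Cmod_triangle (inhom b a0 n) (fshiftn 4 (interaction b a0 e) n)).
  fold N in HN.
  assert (HZ := Cmod_ge_0 (fshiftn 4 (fcst (81 * a9) + fshiftn 2 (fcst (121 * a11)))%fps n)).
  assert (HN0 := Cmod_ge_0 N).
  apply Rle_trans with (Cmod N); [|lra].
  apply Rle_trans with (IZR (Z.abs (wL n)) * (Cmod N / IZR (Z.abs (wL n))))%R.
  - apply Rmult_le_compat_r; [|easy].
    apply Rmult_le_pos; [easy|left; now apply Rinv_0_lt_compat].
  - apply Req_le; field; lra.
Qed.

Lemma solution_converges b a0 a9 a11 e :
  (forall n, e n = solution_step b a0 a9 a11 e n) ->
  exists r M : R, (0 < r)%R /\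
    forall n, (Cmod (series_of a0 e n) * r ^ n <= M)%R.
Proof.
  intros He.
  set (h := (fshiftn 4 (fcst (81 * a9) + fshiftn 2 (fcst (121 * a11))))%fps).
  assert (Hbd : exists H : R, (0 <= H)%R /\ forall r K, (0 <= r <= 1)%R ->
            (fnorm r (inhom b a0) K + fnorm r h K <= H)%R).
  { exists (Cmod (720 * b) + (Cmod (- (240) * a0) + (Cmod 360
            + (Cmod (1800 * b) + Cmod 1800)))
            + (Cmod (81 * a9) + Cmod (121 * a11)))%R.
    split.
    { repeat apply Rplus_le_le_0_compat; apply Cmod_ge_0. }
    intros r K [Hr Hr1].
    assert (Hadd : forall c u x j, (fnorm r u K <= x)%R ->
                     (fnorm r (fcst c + fshiftn j u)%fps K <= Cmod c + x)%R).
    { intros c u x j Hu; eapply Rle_trans; [now apply fnorm_add|].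
      rewrite fnorm_cst; generalize (fnorm_fshiftn r Hr Hr1 j u K); lra. }
    apply Rplus_le_compat.
    - unfold inhom; change fshift with (fshiftn 1).
      repeat apply Hadd; rewrite fnorm_cst; apply Rle_refl.
    - eapply Rle_trans; [apply fnorm_fshiftn; easy|].
      apply Hadd; rewrite fnorm_cst; apply Rle_refl. }
  destruct Hbd as (H & H0 & HH).
  set (B := interaction_bound b a0 (H + 1)).
  assert (HB : (0 <= B)%R).
  { unfold B, interaction_bound.
    generalize (Cmod_ge_0 b) (Cmod_ge_0 a0); intros.
    repeat apply Rplus_le_le_0_compat;
      repeat (apply Rmult_le_pos || apply Rplus_le_le_0_compat); lra. }
  (* Since [r * B <= 1] with [B] the bound at [H + 1], the estimate [S_K <= H + 1] reproduces
     itself. *)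
  pose (r := (/ (B + 1))%R).
  assert (Hr : (0 < r)%R) by (apply Rinv_0_lt_compat; lra).
  assert (HrB : (r * (B + 1) = 1)%R) by (unfold r; field; lra).
  assert (Hr1 : (0 <= r <= 1)%R) by nra.
  assert (HS : forall K, (fnorm r (wt wS e) K <= H + 1)%R).
  { assert (Hstep : forall K, (fnorm r (wt wS e) K <=
              H + fnorm r (fshiftn 4 (interaction b a0 e)) K)%R).
    { intros K; specialize (HH r K Hr1).
      assert (Hgen : forall k u v1 v2 v3,
        (forall n, Cmod (u n) <= Cmod (v1 n) + Cmod (v2 n) + Cmod (v3 n))%R ->
        (fnorm r u k <= fnorm r v1 k + fnorm r v2 k + fnorm r v3 k)%R).
      { induction k as [|k IH]; intros u v1 v2 v3 Hu; simpl; [apply Hu|].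
        generalize (Hu 0%nat) (IH (fun j => u (S j)) (fun j => v1 (S j))
          (fun j => v2 (S j)) (fun j => v3 (S j)) (fun n => Hu (S n))); nra. }
      assert (Hk := Hgen K _ _ _ _
                      (fun n => solution_step_bound b a0 a9 a11 e n (He n))).
      fold h in Hk; lra. }
    induction K as [|K IH].
    - eapply Rle_trans; [apply Hstep|simpl; rewrite Cmod_0; lra].
    - eapply Rle_trans; [apply Hstep|].
      (* One of the four shifts yields the factor [r] and lowers the truncation from [K + 1] to [K];
         the other three are merely discarded. *)
      change (fshiftn 4 (interaction b a0 e))
        with (fshift (fshiftn 3 (interaction b a0 e))).
      rewrite fnorm_fshift.
      assert (HM := fnorm_interaction b a0 e r (H + 1) K Hr1 IH); fold B in HM.
      assert (Hs := fnorm_fshiftn r (proj1 Hr1) (proj2 Hr1) 3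
                      (interaction b a0 e) K).
      nra. }
  exists r, (Cmod a0 + (Cmod (-1) + (H + 1)))%R; split; [easy|intros n].
  eapply Rle_trans; [apply (fnorm_term r (proj1 Hr1))|].
  unfold series_of; change fshift with (fshiftn 1).
  assert (Hadd : forall c u x j, (fnorm r u n <= x)%R ->
                   (fnorm r (fcst c + fshiftn j u)%fps n <= Cmod c + x)%R).
  { intros c u x j Hu; eapply Rle_trans; [now apply fnorm_add|].
    rewrite fnorm_cst.
    generalize (fnorm_fshiftn r (proj1 Hr1) (proj2 Hr1) j u n); lra. }
  apply Hadd, Hadd.
  rewrite <- (Rmult_1_l (H + 1)); eapply Rle_trans; [|apply Rmult_le_compat_l, (HS n); lra].
  apply fnorm_dom; [easy|]; intros k; rewrite Cmod_wt, Rmult_1_l.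
  rewrite <- (Rmult_1_l (Cmod (e k))) at 1.
  apply Rmult_le_compat_r; [apply Cmod_ge_0|].
  apply (IZR_le 1); unfold wS; nia.
Qed.

(** * Complex power series *)

(** Summation by components gives access to the theorems on real series. The sum is total;
    convergence is supplied separately by [absconv]. *)
Definition CSeries (u : fps) : C :=
  (Series (fun n => fst (u n)), Series (fun n => snd (u n))).

Definition absconv (u : fps) : Prop := ex_series (fun n => Cmod (u n)).

Lemma Rabs_fst_le (z : C) : (Rabs (fst z) <= Cmod z)%R.
Proof. eapply Rle_trans; [apply Rmax_l|apply Rmax_Cmod]. Qed.

Lemma Rabs_snd_le (z : C) : (Rabs (snd z) <= Cmod z)%R.
Proof. eapply Rle_trans; [apply Rmax_r|apply Rmax_Cmod]. Qed.

Lemma Cmod_le_add (z : C) : (Cmod z <= Rabs (fst z) + Rabs (snd z))%R.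
Proof.
  replace z with (RtoC (fst z) + RtoC (snd z) * Ci)
    by (destruct z as [x y]; apply injective_projections; simpl; ring).
  eapply Rle_trans; [apply Cmod_triangle|].
  rewrite Cmod_mult, Cmod_Ci, !Cmod_R; simpl.
  rewrite !Rmult_0_l, !Rmult_1_r, !Rmult_0_r, Rminus_0_r, !Rplus_0_r, ?Rplus_0_l.
  apply Rle_refl.
Qed.

Lemma absconv_fst u : absconv u -> ex_series (fun n => Rabs (fst (u n))).
Proof.
  intros H; apply (ex_series_le (V := R_CompleteNormedModule) _ (fun n => Cmod (u n)));
    [|exact H].
  intros n; change (Rabs (Rabs (fst (u n))) <= Cmod (u n))%R.
  rewrite Rabs_Rabsolu; apply Rabs_fst_le.
Qed.

Lemma absconv_snd u : absconv u -> ex_series (fun n => Rabs (snd (u n))).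
Proof.
  intros H; apply (ex_series_le (V := R_CompleteNormedModule) _ (fun n => Cmod (u n)));
    [|exact H].
  intros n; change (Rabs (Rabs (snd (u n))) <= Cmod (u n))%R.
  rewrite Rabs_Rabsolu; apply Rabs_snd_le.
Qed.

(** The factor 2 comes from estimating the two components separately and is harmless below. *)
Lemma Cmod_CSeries u :
  absconv u -> (Cmod (CSeries u) <= 2 * Series (fun n => Cmod (u n)))%R.
Proof.
  intros H; eapply Rle_trans; [apply Cmod_le_add|]; simpl.
  assert (H1 := Series_Rabs _ (absconv_fst u H)).
  assert (H2 := Series_Rabs _ (absconv_snd u H)).
  assert (H3 : (Series (fun n => Rabs (fst (u n))) <= Series (fun n => Cmod (u n)))%R)
    by (apply Series_le; [intros n; split; [apply Rabs_pos|apply Rabs_fst_le]|exact H]).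
  assert (H4 : (Series (fun n => Rabs (snd (u n))) <= Series (fun n => Cmod (u n)))%R)
    by (apply Series_le; [intros n; split; [apply Rabs_pos|apply Rabs_snd_le]|exact H]).
  lra.
Qed.

Lemma CSeries_add u v :
  absconv u -> absconv v -> CSeries (u + v)%fps = CSeries u + CSeries v.
Proof.
  intros Hu Hv; unfold CSeries, Cplus; simpl; f_equal; apply Series_plus;
    apply ex_series_Rabs; auto using absconv_fst, absconv_snd.
Qed.

Lemma absconv_scal c u : absconv u -> absconv (fscal c u).
Proof.
  intros H; unfold absconv, fscal.
  eapply ex_series_ext; [intros n; symmetry; apply Cmod_mult|].
  now apply (ex_series_scal (V := R_NormedModule) (Cmod c)).
Qed.

Lemma CSeries_scal c u : absconv u -> CSeries (fscal c u) = c * CSeries u.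
Proof.
  intros H; unfold CSeries, fscal, Cmult; simpl.
  assert (H1 := ex_series_Rabs _ (absconv_fst u H)).
  assert (H2 := ex_series_Rabs _ (absconv_snd u H)).
  f_equal; rewrite <- !Series_scal_l;
    [rewrite <- Series_minus|rewrite <- Series_plus];
    try apply (ex_series_scal (V := R_NormedModule)); auto; reflexivity.
Qed.

(** Brings the product into the form of the theorem on Cauchy products of absolutely convergent real
    series. *)
Lemma fmul_re_im u v n :
  fmul u v n =
  ((sum_f_R0 (fun k => fst (u k) * fst (v (n - k)%nat)) n
    - sum_f_R0 (fun k => snd (u k) * snd (v (n - k)%nat)) n)%R,
   (sum_f_R0 (fun k => fst (u k) * snd (v (n - k)%nat)) n
    + sum_f_R0 (fun k => snd (u k) * fst (v (n - k)%nat)) n)%R).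
Proof.
  revert u; induction n as [|n IH]; intros u; [reflexivity|].
  assert (D : forall f, (sum_f_R0 f (S n) = f O + sum_f_R0 (fun i => f (S i)) n)%R)
    by (intros f; now rewrite decomp_sum by lia).
  rewrite !D; simpl fmul; rewrite IH; simpl.
  apply injective_projections; simpl; ring.
Qed.

Lemma CSeries_mul u v :
  absconv u -> absconv v -> CSeries (u * v)%fps = CSeries u * CSeries v.
Proof.
  intros Hu Hv.
  assert (H1 := absconv_fst u Hu); assert (H2 := absconv_snd u Hu).
  assert (H3 := absconv_fst v Hv); assert (H4 := absconv_snd v Hv).
  assert (S1 := Series_correct _ (ex_series_Rabs _ H1)).
  assert (S2 := Series_correct _ (ex_series_Rabs _ H2)).
  assert (S3 := Series_correct _ (ex_series_Rabs _ H3)).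
  assert (S4 := Series_correct _ (ex_series_Rabs _ H4)).
  unfold CSeries, Cmult; simpl; f_equal; apply is_series_unique.
  - eapply is_series_ext.
    2: exact (is_series_minus _ _ _ _ (is_series_mult _ _ _ _ S1 S3 H1 H3)
                (is_series_mult _ _ _ _ S2 S4 H2 H4)).
    intros n; rewrite fmul_re_im; reflexivity.
  - eapply is_series_ext.
    2: exact (is_series_plus _ _ _ _ (is_series_mult _ _ _ _ S1 S4 H1 H4)
                (is_series_mult _ _ _ _ S2 S3 H2 H3)).
    intros n; rewrite fmul_re_im; reflexivity.
Qed.

(* [u] has radius of convergence at least [rho]. *)
Definition conv (rho : R) (u : fps) : Prop :=
  forall r, (0 <= r < rho)%R ->
    exists M, forall n, (Cmod (u n) * r ^ n <= M)%R.

Definition ev (u : fps) (w : C) : C := CSeries (fun n => u n * w ^ n).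

(** Boundedness at the midpoint of [r] and [rho] becomes geometric decay at [r]. *)
Lemma conv_geometric rho u r :
  conv rho u -> (0 <= r < rho)%R ->
  exists M q : R, (0 <= M)%R /\ (0 <= q < 1)%R /\
    forall n, (Cmod (u n) * r ^ n <= M * q ^ n)%R.
Proof.
  intros H Hr; destruct (H ((r + rho) / 2)%R) as [M HM]; [lra|].
  set (s := ((r + rho) / 2)%R) in *.
  assert (Hs : (0 < s)%R) by (unfold s; lra).
  assert (Hrs : (r < s)%R) by (unfold s; lra).
  exists M, (r / s)%R; split; [|split].
  - eapply Rle_trans; [|apply (HM O)]; simpl.
    generalize (Cmod_ge_0 (u O)); lra.
  - split; [apply Rle_div_r; lra|apply Rlt_div_l; lra].
  - intros n; unfold Rdiv; rewrite Rpow_mult_distr, pow_inv.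
    assert (Hp : (0 < s ^ n)%R) by (now apply pow_lt).
    replace (M * (r ^ n * / s ^ n))%R with (M * r ^ n / s ^ n)%R
      by (unfold Rdiv; ring).
    apply (proj1 (Rle_div_r _ _ _ Hp)).
    replace (Cmod (u n) * r ^ n * s ^ n)%R with ((Cmod (u n) * s ^ n) * r ^ n)%R
      by ring.
    apply Rmult_le_compat_r; [now apply pow_le|apply HM].
Qed.

Lemma conv_absconv rho u w :
  conv rho u -> (Cmod w < rho)%R -> absconv (fun n => u n * w ^ n).
Proof.
  intros H Hw.
  destruct (conv_geometric rho u (Cmod w) H) as (M & q & _ & Hq & HM).
  { generalize (Cmod_ge_0 w); lra. }
  apply (ex_series_le (V := R_CompleteNormedModule) _ (fun n => M * q ^ n)%R).
  - intros n; change (Rabs (Cmod (u n * w ^ n)) <= M * q ^ n)%R.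
    rewrite Rabs_pos_eq by apply Cmod_ge_0; rewrite Cmod_mult, Cmod_pow; apply HM.
  - apply (ex_series_scal (V := R_NormedModule) M).
    apply ex_series_geom; rewrite Rabs_pos_eq; lra.
Qed.

Lemma conv_add rho u v : conv rho u -> conv rho v -> conv rho (u + v)%fps.
Proof.
  intros Hu Hv r Hr; destruct (Hu r Hr) as [M HM]; destruct (Hv r Hr) as [N HN].
  exists (M + N)%R; intros n; unfold fadd.
  assert (0 <= r ^ n)%R by (apply pow_le; lra).
  generalize (HM n) (HN n) (Cmod_triangle (u n) (v n)); nra.
Qed.

Lemma conv_fcst rho c : conv rho (fcst c).
Proof.
  intros r Hr; exists (Cmod c); intros [|n]; simpl; [lra|].
  rewrite Cmod_0; generalize (Cmod_ge_0 c); lra.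
Qed.

Lemma conv_fshiftn rho k u : conv rho u -> conv rho (fshiftn k u).
Proof.
  intros Hu; induction k as [|k IH]; [exact Hu|]; intros r Hr.
  destruct (IH r Hr) as [M HM]; exists (r * M)%R.
  assert (0 <= M)%R.
  { eapply Rle_trans; [|apply (HM O)]; simpl.
    generalize (Cmod_ge_0 (fshiftn k u O)); lra. }
  intros [|n]; simpl; [rewrite Cmod_0; nra|].
  generalize (HM n); fold (fshiftn k u); nra.
Qed.

(** Geometric decay bounds [fnorm r u K] uniformly in [K], and [fnorm] is submultiplicative. *)
Lemma conv_fmul rho u v : conv rho u -> conv rho v -> conv rho (u * v)%fps.
Proof.
  assert (Hn : forall u, conv rho u -> forall r, (0 <= r < rho)%R ->
                 exists M, forall K, (fnorm r u K <= M)%R).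
  { clear; intros u Hu r Hr.
    destruct (conv_geometric rho u r Hu Hr) as (M & q & HM0 & Hq & HM).
    exists (M * / (1 - q))%R; intros K.
    assert (Hgen : forall K u M, (0 <= M)%R ->
       (forall n, Cmod (u n) * r ^ n <= M * q ^ n)%R ->
       (fnorm r u K <= M * / (1 - q))%R).
    { assert (Hi : (1 <= / (1 - q))%R).
      { rewrite <- Rinv_1 at 1; apply Rinv_le_contravar; lra. }
      induction K0 as [|K0 IH]; intros v N HN0 HN; simpl.
      - generalize (HN O); simpl; nra.
      - destruct (Req_dec r 0) as [->|Hr0].
        { generalize (HN O); simpl; nra. }
        assert (H := IH (fun j => v (S j)) (N * q * / r)%R).
        assert (0 < / r)%R by (apply Rinv_0_lt_compat; lra).
        assert (Hle : (fnorm r (fun j => v (S j)) K0 <= N * q * / r * / (1 - q))%R).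
        { apply H; [repeat apply Rmult_le_pos; lra|].
          intros n; generalize (HN (S n)); simpl; intros Hn.
          apply Rmult_le_reg_l with r; [lra|].
          replace (r * (N * q * / r * q ^ n))%R with (N * (q * q ^ n))%R
            by (field; lra).
          lra. }
        apply (Rmult_le_compat_l r) in Hle; [|lra].
        replace (r * (N * q * / r * / (1 - q)))%R
          with (N * / (1 - q) - N)%R in Hle by (field; lra).
        generalize (HN O); simpl; lra. }
    now apply Hgen. }
  intros Hu Hv r Hr.
  destruct (Hn u Hu r Hr) as [M HM]; destruct (Hn v Hv r Hr) as [N HN].
  exists (M * N)%R; intros n.
  eapply Rle_trans; [apply fnorm_term; lra|].
  eapply Rle_trans; [apply fnorm_mul; lra|].
  apply Rmult_le_compat; auto; apply fnorm_ge0; lra.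
Qed.

(** Since [q <= 1], the quantity [(n + 1) q^n] is at most [1 + q + ... + q^n], a geometric sum. *)
Lemma S_pow_bound q n :
  (0 <= q < 1)%R -> (INR (S n) * q ^ n * (1 - q) <= 1 - q ^ S n)%R.
Proof.
  intros Hq; induction n as [|n IH]; [simpl; lra|].
  rewrite S_INR; rewrite S_INR in IH |- *.
  assert (Hp : (0 <= q ^ n <= 1)%R).
  { split; [now apply pow_le|]; rewrite <- (pow1 n); apply pow_incr; lra. }
  cbn [pow] in *; set (p := (q ^ n)%R) in *; set (N := INR n) in *.
  apply (Rmult_le_compat_l q) in IH; [|lra].
  assert (0 <= (1 - q) * (1 - q * p))%R by (apply Rmult_le_pos; nra).
  nra.
Qed.

(** Geometric decay absorbs a weight linear in [n]. Iteration handles [tder], whose weights are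
    products of such factors. *)
Lemma conv_linear_weight rho A (f : nat -> R) u :
  conv rho u -> (forall n, Rabs (f n) <= A * INR (S n))%R ->
  conv rho (fun n => RtoC (f n) * u n).
Proof.
  intros Hu Hf r Hr.
  destruct (conv_geometric rho u r Hu Hr) as (M & q & HM0 & Hq & HM).
  assert (HA : (0 <= A)%R).
  { generalize (Hf O) (Rabs_pos (f O)); simpl; lra. }
  exists (A * M * / (1 - q))%R; intros n.
  rewrite Cmod_mult, Cmod_R, Rmult_assoc.
  apply Rle_trans with (A * INR (S n) * (M * q ^ n))%R.
  { apply Rmult_le_compat; auto using Rabs_pos.
    apply Rmult_le_pos; [apply Cmod_ge_0|apply pow_le; lra]. }
  replace (A * INR (S n) * (M * q ^ n))%R with (A * M * (INR (S n) * q ^ n))%R by ring.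
  apply Rmult_le_compat_l; [now apply Rmult_le_pos|].
  assert (H := S_pow_bound q n Hq).
  assert (0 <= q ^ S n)%R by (apply pow_le; lra).
  apply Rmult_le_reg_r with (1 - q)%R; [lra|].
  rewrite Rinv_l; lra.
Qed.

Lemma conv_tder rho k a : conv rho a -> conv rho (tder k a).
Proof.
  intros Ha; induction k as [|k IH].
  - intros r Hr; destruct (Ha r Hr) as [M HM]; exists M; intros n.
    unfold tder; simpl; rewrite Cmult_1_l; apply HM.
  - replace (tder (S k) a)
      with (fun n => RtoC (INR n / 3 - INR k)%R * tder k a n).
    2:{ apply functional_extensionality; intros n; unfold tder; cbn [ffact].
        rewrite RtoC_mult; ring. }
    apply (conv_linear_weight rho (1 + INR k)); [exact IH|].
    intros n; rewrite S_INR.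
    generalize (pos_INR n) (pos_INR k); intros; apply Rabs_le; nra.
Qed.

Lemma ev_add rho u v w :
  conv rho u -> conv rho v -> (Cmod w < rho)%R ->
  ev (u + v)%fps w = ev u w + ev v w.
Proof.
  intros Hu Hv Hw; unfold ev.
  rewrite <- CSeries_add by (eapply conv_absconv; eassumption).
  f_equal; apply functional_extensionality; intros n; unfold fadd; ring.
Qed.

Lemma ev_scal rho c u w :
  conv rho u -> (Cmod w < rho)%R -> ev (fscal c u) w = c * ev u w.
Proof.
  intros Hu Hw; unfold ev.
  rewrite <- CSeries_scal by (eapply conv_absconv; eassumption).
  f_equal; apply functional_extensionality; intros n; unfold fscal; ring.
Qed.

Lemma ev_mul rho u v w :
  conv rho u -> conv rho v -> (Cmod w < rho)%R ->
  ev (u * v)%fps w = ev u w * ev v w.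
Proof.
  intros Hu Hv Hw; unfold ev.
  rewrite <- CSeries_mul by (eapply conv_absconv; eassumption).
  f_equal; apply functional_extensionality; intros n; clear Hu.
  revert u; induction n as [|n IH]; intros u; simpl; [ring|].
  replace (fun k : nat => u (S k) * (w * w ^ k))
    with (fun k : nat => w * (u (S k) * w ^ k))
    by (apply functional_extensionality; intros k; ring).
  rewrite fmul_scall, <- (IH (fun k => u (S k))); ring.
Qed.

Lemma Series_eq0 (a : nat -> R) : (forall n, a n = 0%R) -> Series a = 0%R.
Proof.
  intros Ha; rewrite (Series_ext a (fun n => 0 * a n)%R)
    by (intros n; rewrite Ha; ring).
  rewrite Series_scal_l; ring.
Qed.

Lemma ev_incr rho u w :
  conv rho u -> (Cmod w < rho)%R ->
  ev u w = u O + w * ev (fun n => u (S n)) w.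
Proof.
  intros Hu Hw.
  assert (Hs : absconv (fun n => u n * w ^ n)) by (eapply conv_absconv; eassumption).
  assert (Ht : absconv (fscal w (fun n => u (S n) * w ^ n))).
  { unfold absconv; apply ex_series_incr_1 in Hs; revert Hs.
    apply ex_series_ext; intros n; unfold fscal; f_equal; simpl; ring. }
  (* Summability of the tail is obtained on dividing by [w]; for [w = 0] both sides reduce to the
     constant term. *)
  destruct (Req_dec (Cmod w) 0) as [H0|H0].
  - apply Cmod_eq_0 in H0; subst w; unfold ev, CSeries, Cplus, Cmult; simpl.
    f_equal; rewrite Series_incr_1
        by first [ exact (ex_series_Rabs _ (absconv_fst _ Hs))
                 | exact (ex_series_Rabs _ (absconv_snd _ Hs)) ];
      simpl; rewrite Series_eq0 by (intros n; simpl; ring); ring.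
  - assert (Hu' : absconv (fun n => u (S n) * w ^ n)).
    { assert (Hw0 : w <> 0) by (intros ->; apply H0, Cmod_0).
      apply (absconv_scal (/ w)) in Ht; revert Ht; apply ex_series_ext.
      intros n; unfold fscal; f_equal; field; easy. }
    unfold ev; rewrite <- CSeries_scal by exact Hu'.
    unfold CSeries, Cplus, fscal; simpl; f_equal;
      rewrite Series_incr_1
        by first [ exact (ex_series_Rabs _ (absconv_fst _ Hs))
                 | exact (ex_series_Rabs _ (absconv_snd _ Hs)) ];
      f_equal; try (simpl; ring); apply Series_ext; intros n; simpl; ring.
Qed.

Lemma ev_fcst c w : ev (fcst c) w = c.
Proof.
  assert (Hc : conv (Cmod w + 1) (fcst c)) by apply conv_fcst.
  rewrite (ev_incr _ _ _ Hc) by lra; simpl.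
  unfold ev, CSeries; rewrite !Series_eq0 by (intros n; simpl; ring).
  replace (0%R, 0%R) with (RtoC 0) by reflexivity; ring.
Qed.

Lemma ev_fshiftn rho k u w :
  conv rho u -> (Cmod w < rho)%R -> ev (fshiftn k u) w = w ^ k * ev u w.
Proof.
  intros Hu Hw; induction k as [|k IH]; [simpl; ring|].
  rewrite (ev_incr rho) by (easy || now apply conv_fshiftn).
  change (fun n => fshiftn (S k) u (S n)) with (fshiftn k u).
  rewrite IH; simpl; ring.
Qed.

(** * Complex derivatives *)

(** An epsilon-delta form suited to explicit estimates; [Cderiv_is_derive] leads back to the notion
    used in [solves_on_disc]. *)
Definition Cderiv (f : C -> C) (z l : C) : Prop :=
  forall eps : R, (0 < eps)%R -> exists delta : R, (0 < delta)%R /\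
    forall w, (Cmod (w - z) < delta)%R ->
      (Cmod (f w - f z - l * (w - z)) <= eps * Cmod (w - z))%R.

Lemma Cderiv_is_derive f z l :
  Cderiv f z l -> is_derive (K := C_AbsRing) (V := C_NormedModule) f z l.
Proof.
  intros H; split; [apply is_linear_scal_l|].
  intros x Hx eps.
  assert (z = x) as <-
    by (apply (is_filter_lim_locally_unique (K := C_AbsRing) (V := AbsRing_NormedModule C_AbsRing)); exact Hx).
  destruct (H eps (cond_pos eps)) as (delta & Hd & HH).
  exists (mkposreal delta Hd); intros y Hy.
  specialize (HH y Hy).
  change (Cmod (f y - f z - (y - z) * l) <= eps * Cmod (y - z))%R.
  now rewrite (Cmult_comm (y - z) l).
Qed.

(** The common criterion behind the derivatives of the inverse, of power series and of the cube
    root, whose remainders are all quadratic. *)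
Lemma Cderiv_quadratic f z l A d :
  (0 < d)%R ->
  (forall w, (Cmod (w - z) < d)%R ->
     (Cmod (f w - f z - l * (w - z)) <= A * (Cmod (w - z) * Cmod (w - z)))%R) ->
  Cderiv f z l.
Proof.
  intros Hd H eps He.
  assert (HA : (0 < Rabs A + 1)%R) by (generalize (Rabs_pos A); lra).
  exists (Rmin d (eps / (Rabs A + 1))); split.
  { apply Rmin_pos; [easy|]; now apply Rdiv_lt_0_compat. }
  intros w Hw.
  assert (H1 := Rlt_le_trans _ _ _ Hw (Rmin_l _ _)).
  assert (H2 := Rlt_le_trans _ _ _ Hw (Rmin_r _ _)).
  eapply Rle_trans; [now apply H|].
  rewrite <- Rmult_assoc; apply Rmult_le_compat_r; [apply Cmod_ge_0|].
  apply (Rlt_div_r _ _ _ HA) in H2.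
  generalize (Rle_abs A) (Rabs_pos A) (Cmod_ge_0 (w - z)); nra.
Qed.

Lemma Cderiv_continuous f z l :
  Cderiv f z l -> exists A d : R, (0 < d)%R /\ (0 <= A)%R /\
    forall w, (Cmod (w - z) < d)%R -> (Cmod (f w - f z) <= A * Cmod (w - z))%R.
Proof.
  intros H; destruct (H 1%R Rlt_0_1) as (d & Hd & HH).
  exists (Cmod l + 1)%R, d; split; [easy|].
  split; [generalize (Cmod_ge_0 l); lra|]; intros w Hw.
  replace (f w - f z) with ((f w - f z - l * (w - z)) + l * (w - z)) by ring.
  eapply Rle_trans; [apply Cmod_triangle|]; rewrite Cmod_mult.
  generalize (HH w Hw); lra.
Qed.

Lemma Cderiv_comp f g z l m :
  Cderiv g z m -> Cderiv f (g z) l -> Cderiv (fun x => f (g x)) z (l * m).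
Proof.
  intros Hg Hf eps He.
  destruct (Cderiv_continuous _ _ _ Hg) as (A & d & Hd & HA & Hc).
  destruct (Hf (eps / (2 * (A + 1)))%R) as (d1 & Hd1 & Hf1).
  { apply Rdiv_lt_0_compat; lra. }
  assert (Hl : (0 < 2 * (Cmod l + 1))%R) by (generalize (Cmod_ge_0 l); lra).
  destruct (Hg (eps / (2 * (Cmod l + 1)))%R) as (d2 & Hd2 & Hg2).
  { now apply Rdiv_lt_0_compat. }
  exists (Rmin d (Rmin d2 (d1 / (A + 1)))); split.
  { repeat apply Rmin_pos; try easy; apply Rdiv_lt_0_compat; lra. }
  intros w Hw.
  assert (H1 := Rlt_le_trans _ _ _ Hw (Rmin_l _ _)).
  assert (H2 := Rlt_le_trans _ _ _ Hw (Rmin_r _ _)).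
  assert (H3 := Rlt_le_trans _ _ _ H2 (Rmin_l _ _)).
  assert (H4 := Rlt_le_trans _ _ _ H2 (Rmin_r _ _)); clear H2.
  apply Rlt_div_r in H4; [|lra].
  specialize (Hc w H1); specialize (Hg2 w H3).
  set (h := Cmod (w - z)) in *.
  assert (Hh : (0 <= h)%R) by apply Cmod_ge_0.
  specialize (Hf1 (g w)).
  assert (Hlt : (Cmod (g w - g z) < d1)%R) by nra.
  specialize (Hf1 Hlt).
  replace (f (g w) - f (g z) - l * m * (w - z))
    with ((f (g w) - f (g z) - l * (g w - g z)) + l * (g w - g z - m * (w - z)))
    by ring.
  eapply Rle_trans; [apply Cmod_triangle|]; rewrite Cmod_mult.
  assert (B1 : (eps / (2 * (A + 1)) * Cmod (g w - g z) <= eps / 2 * h)%R).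
  { apply Rle_trans with (eps / (2 * (A + 1)) * ((A + 1) * h))%R.
    - apply Rmult_le_compat_l; [left; apply Rdiv_lt_0_compat; lra|nra].
    - apply Req_le; field; lra. }
  assert (B2 : (Cmod l * (eps / (2 * (Cmod l + 1)) * h) <= eps / 2 * h)%R).
  { apply Rle_trans with ((Cmod l + 1) * (eps / (2 * (Cmod l + 1)) * h))%R.
    - apply Rmult_le_compat_r; [|lra].
      apply Rmult_le_pos; [left; now apply Rdiv_lt_0_compat|easy].
    - apply Req_le; field; lra. }
  assert (B3 := Rmult_le_compat_l _ _ _ (Cmod_ge_0 l) Hg2).
  lra.
Qed.

Lemma Cderiv_mult f g z l m :
  Cderiv f z l -> Cderiv g z m ->
  Cderiv (fun x => f x * g x) z (l * g z + f z * m).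
Proof.
  intros Hf Hg eps He.
  destruct (Cderiv_continuous _ _ _ Hf) as (A & d & Hd & HA & Ac).
  destruct (Cderiv_continuous _ _ _ Hg) as (B & d' & Hd' & HB & Bc).
  assert (Kf : (0 < 3 * (Cmod (f z) + 1))%R) by (generalize (Cmod_ge_0 (f z)); lra).
  assert (Kg : (0 < 3 * (Cmod (g z) + 1))%R) by (generalize (Cmod_ge_0 (g z)); lra).
  destruct (Hf (eps / (3 * (Cmod (g z) + 1)))%R) as (d1 & Hd1 & Hf1).
  { now apply Rdiv_lt_0_compat. }
  destruct (Hg (eps / (3 * (Cmod (f z) + 1)))%R) as (d2 & Hd2 & Hg2).
  { now apply Rdiv_lt_0_compat. }
  exists (Rmin (Rmin d d') (Rmin (Rmin d1 d2) (eps / (3 * (A * B + 1))))); split.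
  { repeat apply Rmin_pos; try easy; apply Rdiv_lt_0_compat; nra. }
  intros w Hw.
  assert (H12 := Rlt_le_trans _ _ _ Hw (Rmin_l _ _)).
  assert (H345 := Rlt_le_trans _ _ _ Hw (Rmin_r _ _)).
  assert (H1 := Rlt_le_trans _ _ _ H12 (Rmin_l _ _)).
  assert (H2 := Rlt_le_trans _ _ _ H12 (Rmin_r _ _)).
  assert (H34 := Rlt_le_trans _ _ _ H345 (Rmin_l _ _)).
  assert (H5 := Rlt_le_trans _ _ _ H345 (Rmin_r _ _)).
  assert (H3 := Rlt_le_trans _ _ _ H34 (Rmin_l _ _)).
  assert (H4 := Rlt_le_trans _ _ _ H34 (Rmin_r _ _)).
  clear Hw H12 H345 H34.
  assert (HAB : (0 < 3 * (A * B + 1))%R) by nra.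
  apply (Rlt_div_r _ _ _ HAB) in H5.
  specialize (Ac w H1); specialize (Bc w H2).
  specialize (Hf1 w H3); specialize (Hg2 w H4).
  set (h := Cmod (w - z)) in *.
  assert (Hh : (0 <= h)%R) by apply Cmod_ge_0.
  replace (f w * g w - f z * g z - (l * g z + f z * m) * (w - z))
    with ((f w - f z - l * (w - z)) * g z + f z * (g w - g z - m * (w - z))
          + (f w - f z) * (g w - g z)) by ring.
  eapply Rle_trans; [apply Cmod_triangle|].
  eapply Rle_trans; [apply Rplus_le_compat_r, Cmod_triangle|].
  rewrite !Cmod_mult.
  assert (B1 : (Cmod (f w - f z - l * (w - z)) * Cmod (g z) <= eps / 3 * h)%R).
  { apply Rle_trans with (eps / (3 * (Cmod (g z) + 1)) * h * (Cmod (g z) + 1))%R.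
    - apply Rmult_le_compat; try apply Cmod_ge_0; [easy|lra].
    - apply Req_le; field; lra. }
  assert (B2 : (Cmod (f z) * Cmod (g w - g z - m * (w - z)) <= eps / 3 * h)%R).
  { apply Rle_trans with ((Cmod (f z) + 1) * (eps / (3 * (Cmod (f z) + 1)) * h))%R.
    - apply Rmult_le_compat; try apply Cmod_ge_0; [lra|easy].
    - apply Req_le; field; lra. }
  assert (B3 : (Cmod (f w - f z) * Cmod (g w - g z) <= eps / 3 * h)%R).
  { apply Rle_trans with ((A * h) * (B * h))%R.
    - apply Rmult_le_compat; auto using Cmod_ge_0.
    - assert (0 <= A * B)%R by (now apply Rmult_le_pos). nra. }
  lra.
Qed.

Lemma Cderiv_ext f g z l d :
  (0 < d)%R -> (forall w, (Cmod (w - z) < d)%R -> f w = g w) ->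
  Cderiv f z l -> Cderiv g z l.
Proof.
  intros Hd Hfg Hf eps He; destruct (Hf eps He) as (d1 & Hd1 & H).
  exists (Rmin d d1); split; [now apply Rmin_pos|]; intros w Hw.
  rewrite <- (Hfg w) by exact (Rlt_le_trans _ _ _ Hw (Rmin_l _ _)).
  rewrite <- (Hfg z)
    by (replace (z - z) with (RtoC 0) by ring; now rewrite Cmod_0).
  apply H; exact (Rlt_le_trans _ _ _ Hw (Rmin_r _ _)).
Qed.

Lemma Cderiv_inv (z : C) : z <> 0 -> Cderiv (fun x => / x) z (- / (z * z)).
Proof.
  intros Hz.
  assert (Hm : (0 < Cmod z)%R) by (now apply Cmod_gt_0).
  apply Cderiv_quadratic with (A := (2 / (Cmod z * Cmod z * Cmod z))%R)
                              (d := (Cmod z / 2)%R); [lra|].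
  intros w Hw.
  assert (Hwz : (Cmod z / 2 < Cmod w)%R).
  { assert (H := Cmod_triangle w (z - w)).
    replace (w + (z - w)) with z in H by ring.
    replace (Cmod (z - w)) with (Cmod (w - z)) in H
      by (rewrite <- Cmod_opp; f_equal; ring).
    lra. }
  assert (Hw0 : w <> 0) by (intros ->; rewrite Cmod_0 in Hwz; lra).
  replace (/ w - / z - - / (z * z) * (w - z))
    with ((w - z) * (w - z) * / (w * (z * z))) by (field; auto).
  rewrite !Cmod_mult, Cmod_inv by (repeat apply Cmult_neq_0; easy).
  rewrite !Cmod_mult, (Rmult_comm (2 / _)).
  apply Rmult_le_compat_l.
  { apply Rmult_le_pos; apply Cmod_ge_0. }
  replace (2 / (Cmod z * Cmod z * Cmod z))%R
    with (/ (Cmod z / 2 * (Cmod z * Cmod z)))%R by (field; lra).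
  apply Rinv_le_contravar.
  - repeat apply Rmult_lt_0_compat; lra.
  - apply Rmult_le_compat_r; [|lra]; apply Rmult_le_pos; lra.
Qed.

Lemma Cderiv_inv_pow k (z : C) :
  z <> 0 -> Cderiv (fun x => / x ^ k) z (- RtoC (INR k) / z ^ S k).
Proof.
  intros Hz; induction k as [|k IH].
  - intros eps He; exists 1%R; split; [lra|]; intros w _.
    match goal with |- (Cmod ?x <= _)%R => replace x with (RtoC 0) end.
    + rewrite Cmod_0; apply Rmult_le_pos; [lra|apply Cmod_ge_0].
    + simpl; field; easy.
  - assert (Hz' : (0 < Cmod z)%R) by (now apply Cmod_gt_0).
    apply (Cderiv_ext (fun x => / x * / x ^ k)) with (d := Cmod z); [easy| |].
    + intros w Hw.
      assert (Hw0 : w <> 0).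
      { intros ->; replace (0 - z) with (- z) in Hw by ring.
        rewrite Cmod_opp in Hw; lra. }
      simpl; field; split; [now apply Cpow_nz|easy].
    + assert (H := Cderiv_mult _ _ _ _ _ (Cderiv_inv z Hz) IH).
      replace (- RtoC (INR (S k)) / z ^ S (S k))
        with (- / (z * z) * / z ^ k + / z * (- INR k / z ^ S k)); [exact H|].
      rewrite S_INR, RtoC_plus; simpl; field; split; [now apply Cpow_nz|easy].
Qed.

(** The remainders satisfy [R_(n+1) = w R_n + n z^(n-1) (w - z)^2], which yields the bound because
    [n^2 + n <= (n + 1)^2]. The form [z^n / z] avoids a truncated subtraction at [n = 0]. *)
Lemma pow_remainder (z w : C) (r : R) n :
  z <> 0 -> (Cmod z <= r)%R -> (Cmod w <= r)%R ->
  (Cmod (w ^ n - z ^ n - INR n * (z ^ n / z) * (w - z))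
   <= INR n * INR n * r ^ n / (r * r) * (Cmod (w - z) * Cmod (w - z)))%R.
Proof.
  intros Hz Hzr Hwr.
  assert (Hr : (0 < r)%R) by (apply Cmod_gt_0 in Hz; lra).
  set (h := (Cmod (w - z) * Cmod (w - z))%R).
  assert (Hh : (0 <= h)%R) by (apply Rmult_le_pos; apply Cmod_ge_0).
  induction n as [|n IH].
  - simpl; match goal with |- (Cmod ?x <= _)%R => replace x with (RtoC 0) by ring end.
    rewrite Cmod_0; lra.
  - replace (w ^ S n - z ^ S n - INR (S n) * (z ^ S n / z) * (w - z))
      with (w * (w ^ n - z ^ n - INR n * (z ^ n / z) * (w - z))
            + INR n * (z ^ n / z) * ((w - z) * (w - z)))
      by (rewrite S_INR, RtoC_plus; simpl; field; easy).
    eapply Rle_trans; [apply Cmod_triangle|].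
    assert (Hzn : (Cmod (INR n * (z ^ n / z)) <= INR n * (r ^ n / r))%R).
    { destruct n as [|n].
      { simpl; rewrite Cmult_0_l, Cmod_0; lra. }
      rewrite Cmod_mult, Cmod_R, Rabs_pos_eq by apply pos_INR.
      apply Rmult_le_compat_l; [apply pos_INR|].
      rewrite Cmod_div, Cmod_pow by easy; simpl.
      replace (Cmod z * Cmod z ^ n / Cmod z)%R with (Cmod z ^ n)%R
        by (field; apply Cmod_gt_0 in Hz; lra).
      replace (r * r ^ n / r)%R with (r ^ n)%R by (field; lra).
      apply pow_incr; split; [apply Cmod_ge_0|easy]. }
    rewrite !(Cmod_mult w), (Cmod_mult (INR n * (z ^ n / z))), (Cmod_mult (w - z)).
    fold h; rewrite S_INR; simpl.
    assert (H1 : (Cmod w * Cmod (w ^ n - z ^ n - INR n * (z ^ n / z) * (w - z))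
              <= r * (INR n * INR n * r ^ n / (r * r) * h))%R).
    { apply Rmult_le_compat; auto using Cmod_ge_0. }
    assert (H2 : (Cmod (INR n * (z ^ n / z)) * h <= INR n * (r ^ n / r) * h)%R)
      by (now apply Rmult_le_compat_r).
    replace ((INR n + 1) * (INR n + 1) * (r * r ^ n) / (r * r) * h)%R
      with (r * (INR n * INR n * r ^ n / (r * r) * h) + INR n * (r ^ n / r) * h
            + (INR n + 1) * r ^ n / r * h)%R by (field; lra).
    assert (0 <= (INR n + 1) * r ^ n / r * h)%R.
    { assert (Hn := pos_INR n); assert (Hrn : (0 <= r ^ n)%R) by (apply pow_le; lra).
      assert (Hri : (0 <= / r)%R) by (left; now apply Rinv_0_lt_compat).
      apply Rmult_le_pos; [|easy]; apply Rmult_le_pos; [|easy].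
      apply Rmult_le_pos; lra. }
    lra.
Qed.

(** Summing [pow_remainder] over [n] gives a quadratic remainder, whose constant involves the sum of
    [n^2 |u_n| r^n] at a radius [r] midway to [rho]. The Euler form [z f'] matches the polynomial
    weights of [tder]. *)
Lemma ev_deriv rho u (z : C) :
  conv rho u -> z <> 0 -> (Cmod z < rho)%R ->
  Cderiv (ev u) z (ev (fun n => INR n * u n) z / z).
Proof.
  intros Hu Hz Hzr.
  set (r := ((Cmod z + rho) / 2)%R).
  assert (Hz' : (0 < Cmod z)%R) by (now apply Cmod_gt_0).
  assert (Hr : (Cmod z < r < rho)%R) by (unfold r; lra).
  assert (HN : conv rho (fun n => INR n * u n)).
  { apply (conv_linear_weight rho 1); [easy|]; intros n.
    rewrite S_INR, Rabs_pos_eq by apply pos_INR; lra. }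
  assert (HNN : conv rho (fun n => INR n * (INR n * u n))).
  { apply (conv_linear_weight rho 1 INR (fun n => INR n * u n)); [easy|]; intros n.
    rewrite S_INR, Rabs_pos_eq by apply pos_INR; lra. }
  assert (Hac : absconv (fun n => INR n * (INR n * u n) * RtoC r ^ n)).
  { apply (conv_absconv rho _ _ HNN); rewrite Cmod_R, Rabs_pos_eq; lra. }
  set (T := Series (fun n => Cmod (INR n * (INR n * u n) * RtoC r ^ n))).
  apply Cderiv_quadratic with (A := (2 * T / (r * r))%R) (d := (r - Cmod z)%R);
    [lra|].
  intros w Hw.
  assert (Hwr : (Cmod w < r)%R).
  { replace w with (z + (w - z)) by ring.
    generalize (Cmod_triangle z (w - z)); lra. }
  set (h := (Cmod (w - z) * Cmod (w - z))%R).
  pose (q := fun n => u n * (w ^ n - z ^ n - INR n * (z ^ n / z) * (w - z))).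
  assert (Hq : forall n, (Cmod (q n)
     <= h / (r * r) * Cmod (INR n * (INR n * u n) * RtoC r ^ n))%R).
  { intros n; unfold q; rewrite !Cmod_mult, Cmod_pow, !Cmod_R.
    rewrite !(Rabs_pos_eq (INR n)) by apply pos_INR.
    rewrite (Rabs_pos_eq r) by lra.
    assert (Hp := pow_remainder z w r n Hz (Rlt_le _ _ (proj1 Hr)) (Rlt_le _ _ Hwr)).
    fold h in Hp.
    apply (Rmult_le_compat_l _ _ _ (Cmod_ge_0 (u n))) in Hp.
    eapply Rle_trans; [exact Hp|apply Req_le; field; lra]. }
  assert (Hqs : ex_series (fun n => (h / (r * r)
                  * Cmod (INR n * (INR n * u n) * RtoC r ^ n))%R))
    by (now apply (ex_series_scal (V := R_NormedModule) (h / (r * r))%R)).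
  assert (Hqa : absconv q).
  { apply (ex_series_le (V := R_CompleteNormedModule) _ _) with (2 := Hqs).
    intros n; change (Rabs (Cmod (q n)) <= h / (r * r)
                  * Cmod (INR n * (INR n * u n) * RtoC r ^ n))%R.
    rewrite Rabs_pos_eq by apply Cmod_ge_0; apply Hq. }
  replace (ev u w - ev u z - ev (fun n => INR n * u n) z / z * (w - z))
    with (CSeries q).
  - eapply Rle_trans; [now apply Cmod_CSeries|].
    replace (2 * T / (r * r) * h)%R with (2 * (h / (r * r) * T))%R
      by (field; lra).
    apply Rmult_le_compat_l; [lra|]; unfold T; rewrite <- Series_scal_l.
    apply Series_le; [|exact Hqs].
    intros n; split; [apply Cmod_ge_0|apply Hq].
  - unfold ev.
    replace q with (fadd (fun n => u n * w ^ n)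
      (fadd (fscal (-1) (fun n => u n * z ^ n))
         (fscal (- ((w - z) / z)) (fun n => INR n * u n * z ^ n)))).
    2:{ apply functional_extensionality; intros n; unfold fadd, fscal, q.
        field; easy. }
    assert (A1 : absconv (fun n => u n * w ^ n))
      by (apply (conv_absconv rho _ _ Hu); lra).
    assert (A2 : absconv (fun n => u n * z ^ n))
      by (apply (conv_absconv rho _ _ Hu); lra).
    assert (A3 : absconv (fun n => INR n * u n * z ^ n))
      by (apply (conv_absconv rho _ _ HN); lra).
    assert (Ha : forall x y, absconv x -> absconv y -> absconv (x + y)%fps).
    { intros x y Hx Hy.
      assert (Hxy := ex_series_plus (V := R_NormedModule) _ _ Hx Hy).
      apply (ex_series_le (V := R_CompleteNormedModule) _ _) with (2 := Hxy).
      intros n; change (Rabs (Cmod (x n + y n)) <= Cmod (x n) + Cmod (y n))%R.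
      rewrite Rabs_pos_eq by apply Cmod_ge_0; apply Cmod_triangle. }
    rewrite !CSeries_add, !CSeries_scal by auto using absconv_scal.
    field; easy.
Qed.

(** * Cube root and local solutions *)

(* The branch of the cube root on the right half-plane. *)
Definition ccbrt (z : C) : C :=
  let r := Rpower (Cmod z) (1 / 3) in
  let t := (atan (snd z / fst z) / 3)%R in
  (r * cos t, r * sin t)%R.

(** The sector [|arg c| <= pi / 6], where the cube roots from the right half-plane lie. *)
Definition sector (c : C) : Prop :=
  (0 < fst c)%R /\ (3 * (snd c * snd c) <= fst c * fst c)%R.

(** The triple angle formulas give the cube. As [cos (3 t)] and [cos t] are positive, so is
    [cos^2 t - 3 sin^2 t], which is the sector condition. *)
Lemma ccbrt_spec (z : C) :
  (0 < fst z)%R -> ccbrt z ^ 3 = z /\ sector (ccbrt z).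
Proof.
  destruct z as [x y]; simpl; intros Hx; unfold ccbrt; cbn [fst snd].
  set (q := (y / x)%R); set (t := (atan q / 3)%R).
  assert (Hq : (0 < 1 + q * q)%R) by nra.
  assert (Hsq : (0 < sqrt (1 + q * q))%R) by (now apply sqrt_lt_R0).
  assert (Hm : Cmod (x, y) = (x * sqrt (1 + q * q))%R).
  { unfold Cmod; simpl.
    replace (x * (x * 1) + y * (y * 1))%R with (x * x * (1 + q * q))%R
      by (unfold q; field; lra).
    rewrite sqrt_mult_alt by nra; now rewrite sqrt_square by lra. }
  assert (Hm0 : (0 < Cmod (x, y))%R) by (rewrite Hm; now apply Rmult_lt_0_compat).
  set (r := Rpower (Cmod (x, y)) (1 / 3)).
  assert (Hr : (0 < r)%R) by apply exp_pos.
  assert (Hr3 : (r * (r * r) = x * sqrt (1 + q * q))%R).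
  { rewrite <- Hm; replace (r * (r * r))%R with (r ^ 3)%R by ring.
    rewrite <- Rpower_pow by easy; unfold r; rewrite Rpower_mult.
    replace (1 / 3 * INR 3)%R with 1%R by (simpl; field); now apply Rpower_1. }
  assert (Hc3 : (cos t * (cos t * cos t) - 3 * (cos t * (sin t * sin t))
                 = 1 / sqrt (1 + q * q))%R).
  { replace (1 / sqrt (1 + q * q))%R with (cos (t + t + t))
      by (replace (t + t + t)%R with (atan q) by (unfold t; field);
          apply cos_atan).
    rewrite !cos_plus, sin_plus; ring. }
  assert (Hs3 : (3 * (cos t * cos t * sin t) - sin t * (sin t * sin t)
                 = q / sqrt (1 + q * q))%R).
  { replace (q / sqrt (1 + q * q))%R with (sin (t + t + t))
      by (replace (t + t + t)%R with (atan q) by (unfold t; field);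
          apply sin_atan).
    rewrite !sin_plus, cos_plus; ring. }
  assert (Hct : (0 < cos t)%R).
  { generalize (atan_bound q); intros [B1 B2]; generalize PI_RGT_0; intros HP.
    apply cos_gt_0; unfold t; lra. }
  split.
  - apply injective_projections; simpl.
    + transitivity (r * (r * r) * (cos t * (cos t * cos t)
                      - 3 * (cos t * (sin t * sin t))))%R; [ring|].
      rewrite Hr3, Hc3; field; lra.
    + transitivity (r * (r * r) * (3 * (cos t * cos t * sin t)
                      - sin t * (sin t * sin t)))%R; [ring|].
      rewrite Hr3, Hs3; unfold q; field; unfold q in *; lra.
  - split; simpl; [now apply Rmult_lt_0_compat|].
    assert (H1 := sin2_cos2 t); unfold Rsqr in H1.
    assert (Hpos : (0 < cos t * (cos t * cos t) - 3 * (cos t * (sin t * sin t)))%R).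
    { rewrite Hc3; apply Rdiv_lt_0_compat; lra. }
    assert (H2 : (0 < cos t * cos t - 3 * (sin t * sin t))%R).
    { apply Rmult_lt_reg_l with (cos t); lra. }
    assert (0 < r * r)%R by (now apply Rmult_lt_0_compat).
    nra.
Qed.

(** This is the cofactor of [d - c] in [d^3 - c^3]. The three products have arguments at most
    [pi / 3] in modulus, hence non-negative real parts, and that of [c * c] alone reaches the
    bound. *)
Lemma sector_factor (c d : C) :
  sector c -> sector d ->
  (2 / 3 * (fst c * fst c) <= Cmod (d * d + d * c + c * c))%R.
Proof.
  destruct c as [x y], d as [u v]; unfold sector; simpl; intros [Hx Hy] [Hu Hv].
  eapply Rle_trans; [|apply Rabs_fst_le]; simpl.
  eapply Rle_trans; [|apply Rle_abs].
  assert (v * y <= u * x)%R.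
  { assert (0 < u * x)%R by (now apply Rmult_lt_0_compat).
    destruct (Rle_lt_dec (v * y) 0); [lra|].
    apply Rsqr_incr_0_var; [|lra]; unfold Rsqr.
    assert (v * v * (y * y) <= u * u * (x * x))%R
      by (apply Rmult_le_compat; nra).
    nra. }
  nra.
Qed.

Lemma sector_lipschitz (c d : C) :
  sector c -> sector d ->
  (2 / 3 * (fst c * fst c) * Cmod (d - c) <= Cmod (d ^ 3 - c ^ 3))%R.
Proof.
  intros Hc Hd.
  replace (d ^ 3 - c ^ 3) with ((d * d + d * c + c * c) * (d - c)) by ring.
  rewrite Cmod_mult; apply Rmult_le_compat_r; [apply Cmod_ge_0|].
  now apply sector_factor.
Qed.

Lemma ccbrt_pow3 (x : R) : (0 < x)%R -> ccbrt (RtoC (x ^ 3)) = RtoC x.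
Proof.
  intros Hx.
  assert (Hx3 : (0 < x ^ 3)%R) by (now apply pow_lt).
  destruct (ccbrt_spec (RtoC (x ^ 3)) Hx3) as [H3 Hs].
  set (c := ccbrt (RtoC (x ^ 3))) in *; rewrite RtoC_pow in H3.
  assert (Hx' : sector (RtoC x)) by (split; simpl; nra).
  assert (H := sector_lipschitz _ _ Hx' Hs).
  rewrite H3 in H; replace (RtoC x ^ 3 - RtoC x ^ 3) with (RtoC 0) in H by ring.
  rewrite Cmod_0 in H; simpl in H.
  apply Ceq_minus, Cmod_eq_0.
  assert (H0 := Cmod_ge_0 (c - RtoC x)).
  assert (0 < x * x)%R by nra.
  destruct (Rle_lt_or_eq_dec _ _ H0) as [Hlt|Heq]; [|easy].
  exfalso; assert (0 < 2 / 3 * (x * x) * Cmod (c - x))%R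
    by (apply Rmult_lt_0_compat; lra).
  lra.
Qed.

Lemma ccbrt_neq0 (z : C) : (0 < fst z)%R -> ccbrt z <> 0.
Proof.
  intros Hz H; destruct (ccbrt_spec z Hz) as [_ [Hs _]].
  rewrite H in Hs; simpl in Hs; lra.
Qed.

Lemma Cderiv_ccbrt (z : C) :
  (0 < fst z)%R -> Cderiv ccbrt z (/ (3 * (ccbrt z * ccbrt z))).
Proof.
  intros Hz; destruct (ccbrt_spec z Hz) as [H3 Hs].
  assert (Hc0 := ccbrt_neq0 z Hz).
  set (c := ccbrt z) in *.
  set (m := (2 / 3 * (fst c * fst c))%R).
  assert (Hm : (0 < m)%R) by (destruct Hs; unfold m; nra).
  assert (Hcm : (0 < Cmod c)%R) by (now apply Cmod_gt_0).
  apply Cderiv_quadratic with (d := fst z)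
    (A := (/ m * (3 * Cmod c + fst z / m) * / (3 * (Cmod c * Cmod c) * m))%R);
    [easy|].
  intros w Hw.
  assert (Hw0 : (0 < fst w)%R).
  { generalize (Rabs_fst_le (w - z)); simpl; intros H.
    assert (H' : (Rabs (fst w + - fst z) < fst z)%R) by lra.
    apply Rabs_def2 in H'; lra. }
  destruct (ccbrt_spec w Hw0) as [H3' Hs']; fold c.
  set (d := ccbrt w) in *.
  assert (Hl := sector_lipschitz c d Hs Hs'); rewrite H3, H3' in Hl; fold m in Hl.
  assert (HS := sector_factor c d Hs Hs'); fold m in HS.
  set (S := d * d + d * c + c * c) in *.
  assert (HS0 : S <> 0) by (intros H; rewrite H, Cmod_0 in HS; lra).
  (* Here [w - z = S (d - c)], and [3 c^2 - S] is divisible by [c - d]; this exhibits two factors of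
     order [h]. *)
  replace (d - c - / (3 * (c * c)) * (w - z))
    with ((c - d) * (3 * c + (d - c)) * (w - z) * / (3 * (c * c) * S)).
  2:{ rewrite <- H3, <- H3'.
      replace (d ^ 3 - c ^ 3) with (S * (d - c)) by (unfold S; ring).
      unfold S in *; field; auto. }
  assert (H30 : RtoC 3 <> 0) by (intros H; apply RtoC_inj in H; lra).
  set (h := Cmod (w - z)) in *.
  assert (Hdc : (Cmod (d - c) <= h / m)%R)
    by (apply (proj1 (Rle_div_r _ _ _ Hm)); lra).
  assert (Hcd : (Cmod (c - d) <= h / m)%R)
    by (rewrite <- Cmod_opp; replace (- (c - d)) with (d - c) by ring; easy).
  rewrite !Cmod_mult, Cmod_inv by exact (Cmult_neq_0 _ _ (Cmult_neq_0 _ _ H30 (Cmult_neq_0 _ _ Hc0 Hc0)) HS0).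
  rewrite !Cmod_mult; fold h.
  assert (HC3 : Cmod 3 = 3%R) by (rewrite Cmod_R; apply Rabs_pos_eq; lra).
  rewrite HC3.
  assert (Hh : (0 <= h)%R) by apply Cmod_ge_0.
  assert (B : (Cmod (3 * c + (d - c)) <= 3 * Cmod c + fst z / m)%R).
  { eapply Rle_trans; [apply Cmod_triangle|].
    rewrite Cmod_mult, HC3.
    apply Rplus_le_compat_l; eapply Rle_trans; [exact Hdc|].
    apply Rmult_le_compat_r; [left; now apply Rinv_0_lt_compat|lra]. }
  clearbody m h.
  assert (BI : (/ (3 * (Cmod c * Cmod c) * Cmod S) <= / (3 * (Cmod c * Cmod c) * m))%R).
  { apply Rinv_le_contravar; [repeat apply Rmult_lt_0_compat; lra|].
    apply Rmult_le_compat_l; [repeat apply Rmult_le_pos; lra|easy]. }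
  assert (HI : (0 <= / (3 * (Cmod c * Cmod c) * Cmod S))%R).
  { left; apply Rinv_0_lt_compat; repeat apply Rmult_lt_0_compat; lra. }
  apply Rle_trans with
    (h / m * (3 * Cmod c + fst z / m) * h * / (3 * (Cmod c * Cmod c) * m))%R.
  - apply Rmult_le_compat; [|easy| |easy].
    + repeat apply Rmult_le_pos; auto using Cmod_ge_0.
    + apply Rmult_le_compat_r; [easy|].
      apply Rmult_le_compat; auto using Cmod_ge_0.
  - apply Req_le; unfold Rdiv; ring.
Qed.

(* The [k]-th derivative of the branch of the Puiseux series. *)
Definition sol (b : C) (a : fps) (k : nat) (z : C) : C :=
  ev (tder k a) (ccbrt (z - b)) * / (z - b) ^ k.

(** Differentiation through the cube root multiplies the [n]-th coefficient by [n / 3] and divides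
    by [c^3 = z - b]; the power [(z - b)^(-k)] contributes [-k]. The sum [n / 3 - k] is the weight
    that leads from [tder k] to [tder (S k)]. *)
Lemma sol_deriv rho b a k z :
  conv rho a -> (0 < fst (z - b)%C)%R -> (Cmod (ccbrt (z - b)) < rho)%R ->
  Cderiv (sol b a k) z (sol b a (S k) z).
Proof.
  intros Ha Hz Hr.
  assert (Hc := ccbrt_neq0 _ Hz).
  destruct (ccbrt_spec _ Hz) as [H3 _].
  assert (Hzb : z - b <> 0) by (rewrite <- H3; now apply Cpow_nz).
  assert (Ht := conv_tder rho k a Ha).
  assert (Hshift : Cderiv (fun x => x - b) z 1).
  { intros eps He; exists 1%R; split; [lra|]; intros w _.
    replace (w - b - (z - b) - 1 * (w - z)) with (RtoC 0) by ring.
    rewrite Cmod_0; apply Rmult_le_pos; [lra|apply Cmod_ge_0]. }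
  assert (D1 := Cderiv_comp ccbrt _ z _ _ Hshift (Cderiv_ccbrt _ Hz)).
  assert (D2 := Cderiv_comp (ev (tder k a)) _ z _ _ D1 (ev_deriv rho _ _ Ht Hc Hr)).
  assert (D3 := Cderiv_comp (fun x => / x ^ k) _ z _ _ Hshift (Cderiv_inv_pow k _ Hzb)).
  assert (D := Cderiv_mult _ _ _ _ _ D2 D3).
  match type of D with Cderiv _ _ ?l => replace (sol b a (S k) z) with l; [exact D|] end.
  unfold sol.
  assert (HN : conv rho (fun n => INR n * tder k a n)).
  { apply (conv_linear_weight rho 1); [easy|]; intros n.
    rewrite S_INR, Rabs_pos_eq by apply pos_INR; lra. }
  replace (tder (S k) a)
    with (fadd (fscal (/ 3) (fun n => INR n * tder k a n))
               (fscal (- INR k) (tder k a))).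
  2:{ apply functional_extensionality; intros n; unfold fadd, fscal, tder.
      cbn [ffact]; rewrite RtoC_mult, RtoC_minus, RtoC_div by lra; field. }
  assert (Hsc : forall c u, conv rho u -> conv rho (fscal c u)).
  { intros c u Hu; rewrite fscalE; now apply conv_fmul; [apply conv_fcst|]. }
  rewrite (ev_add rho), !(ev_scal rho) by auto.
  set (c := ccbrt (z - b)) in *.
  set (E := ev (tder k a) c); set (F := ev (fun n => INR n * tder k a n) c).
  rewrite <- H3.
  replace ((c ^ 3) ^ S k) with (c ^ 3 * (c ^ 3) ^ k) by reflexivity.
  assert (Hck : (c ^ 3) ^ k <> 0) by (now repeat apply Cpow_nz).
  set (q := (c ^ 3) ^ k) in *; simpl Cpow; field; auto.
Qed.

(** Inside the radius of convergence [ev] respects sums and products, and it sends [cleared_lhs] to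
    [(z - b)^5 = c^15] times the left-hand side of the equation. *)
Lemma sol_ode rho b a z :
  conv rho a -> cleared_lhs b a = fcst 0 ->
  (0 < fst (z - b)%C)%R -> (Cmod (ccbrt (z - b)) < rho)%R ->
  the_ode z (fun k => sol b a k z) = 0.
Proof.
  intros Ha HL Hz Hr.
  assert (Hc := ccbrt_neq0 _ Hz).
  destruct (ccbrt_spec _ Hz) as [H3 _].
  set (c := ccbrt (z - b)) in *.
  assert (HE : ev (cleared_lhs b a) c = 0) by (rewrite HL; apply ev_fcst).
  assert (Ht := fun k => conv_tder rho k a Ha).
  assert (Hrt : conv rho (fcst b + fshiftn 3 (fcst 1))%fps)
    by (apply conv_add; [|apply conv_fshiftn]; apply conv_fcst).
  unfold cleared_lhs in HE.
  repeat first
    [ rewrite ev_fcst in HE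
    | (rewrite (ev_add rho) in HE || rewrite (ev_mul rho) in HE
       || rewrite (ev_fshiftn rho) in HE);
      [|solve [repeat first [ apply Ht | exact Ha | exact Hrt | exact Hr
                            | apply conv_fcst | apply conv_add
                            | apply conv_fshiftn | apply conv_fmul ]]..] ].
  unfold the_ode, sol; fold c.
  replace (tder 0 a) with a
    by (apply functional_extensionality; intros n; unfold tder; simpl; ring).
  set (y0 := ev a c) in *; set (y1 := ev (tder 1 a) c) in *.
  set (y2 := ev (tder 2 a) c) in *; set (y4 := ev (tder 4 a) c) in *.
  assert (Hzc : z = b + c ^ 3) by (rewrite H3; ring).
  replace (z - b) with (c ^ 3) by (rewrite H3; ring).
  rewrite Hzc at 1 2.
  assert (Hc15 : c ^ 15 <> 0) by (now apply Cpow_nz).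
  match goal with |- ?x = _ => assert (Hx : c ^ 15 * x = 0) end.
  { rewrite <- HE; field; auto. }
  apply (f_equal (fun x => / c ^ 15 * x)) in Hx.
  rewrite Cmult_assoc, Cinv_l, Cmult_1_l in Hx by easy.
  rewrite Hx; ring.
Qed.

(** * Real analyticity of the branch *)

(** The product [(n + 1) ... (n + k) = (n + k)! / n!], an integer majorant of the weights of
    [tder k]. *)
Fixpoint rising (n k : nat) : R :=
  match k with O => 1%R | S j => (rising n j * INR (n + 1 + j)%nat)%R end.

(** Pascal's rule multiplied by [(k + 1)!]. *)
Lemma rising_pascal n k :
  rising (S n) (S k) = (INR (S k) * rising (S n) k + rising n (S k))%R.
Proof.
  assert (H : forall k, (rising n (S k) = INR (n + 1) * rising (S n) k)%R).
  { clear; induction k as [|k IH]; [simpl; rewrite Nat.add_0_r; ring|].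
    change (rising n (S (S k))) with (rising n (S k) * INR (n + 1 + S k))%R.
    rewrite IH; cbn [rising].
    replace (S n + 1 + k)%nat with (n + 1 + S k)%nat by lia; ring. }
  rewrite H; cbn [rising].
  replace (S n + 1 + k)%nat with (S k + (n + 1))%nat by lia.
  rewrite (plus_INR (S k)); ring.
Qed.

(* The binomial theorem bounds [C(n + k, k) d^k] by [(1 + d)^(n + k)]. *)
Lemma rising_bound (d : R) n k :
  (0 <= d)%R -> (rising n k * d ^ k <= INR (fact k) * (1 + d) ^ (n + k))%R.
Proof.
  intros Hd; revert n; induction k as [|k IHk]; intros n.
  { simpl; rewrite Nat.add_0_r.
    assert (H := pow_R1_Rle (1 + d) n); lra. }
  assert (Hf : INR (fact (S k)) = (INR (S k) * INR (fact k))%R)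
    by (now rewrite fact_simpl, mult_INR).
  assert (Hk := pos_INR (S k)); assert (Hfk := pos_INR (fact k)).
  induction n as [|n IHn].
  - assert (H0 : forall k, rising 0 k = INR (fact k)).
    { clear; induction k as [|k IH]; [reflexivity|].
      rewrite fact_simpl, mult_INR; cbn [rising]; rewrite IH.
      change (0 + 1 + k)%nat with (S k); ring. }
    rewrite H0; apply Rmult_le_compat_l; [apply pos_INR|].
    apply pow_incr; lra.
  - rewrite rising_pascal.
    assert (E : ((1 + d) ^ (S n + S k) = d * (1 + d) ^ (S n + k) + (1 + d) ^ (n + S k))%R).
    { replace (n + S k)%nat with (S n + k)%nat by lia.
      replace (S n + S k)%nat with (S (S n + k))%nat by lia; simpl; ring. }
    rewrite E; assert (H := IHk (S n)).
    apply (Rmult_le_compat_l (INR (S k) * d)) in H; [|now apply Rmult_le_pos].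
    rewrite Hf in *; simpl pow in *; nra.
Qed.

Lemma ffact_rising k n : (Rabs (ffact k (INR n / 3)) <= rising n k)%R.
Proof.
  induction k as [|k IH]; simpl; [rewrite Rabs_R1; lra|].
  rewrite Rabs_mult; apply Rmult_le_compat; auto using Rabs_pos.
  rewrite !plus_INR; generalize (pos_INR n) (pos_INR k); simpl; intros.
  apply Rabs_le; lra.
Qed.

(** A substitute for Cauchy's estimates: by [rising_bound] the weights cost [k! ((1 + d) / d)^k] and
    an enlargement of the radius from [r] to [(1 + d) r], which is the midpoint of [r] and [rho]. *)
Lemma ev_tder_bound rho a r :
  conv rho a -> (0 < r < rho)%R ->
  exists M A : R, (0 <= M)%R /\ (0 < A)%R /\
    forall k w, (Cmod w <= r)%R ->
      (Cmod (ev (tder k a) w) <= M * A ^ k * INR (fact k))%R.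
Proof.
  intros Ha Hr.
  set (d := ((rho - r) / (2 * r))%R).
  assert (Hd : (0 < d)%R) by (apply Rdiv_lt_0_compat; lra).
  assert (Hdr : ((1 + d) * r = (rho + r) / 2)%R) by (unfold d; field; lra).
  assert (Hac : absconv (fun n => a n * RtoC ((1 + d) * r)%R ^ n)).
  { apply (conv_absconv rho _ _ Ha); rewrite Cmod_R, Rabs_pos_eq; lra. }
  set (T := Series (fun n => Cmod (a n * RtoC ((1 + d) * r)%R ^ n))).
  assert (HT : (0 <= T)%R).
  { unfold T; rewrite <- (Series_eq0 (fun _ => 0%R)) by reflexivity.
    apply Series_le; [|exact Hac]; intros n; split; [lra|apply Cmod_ge_0]. }
  exists (2 * T)%R, ((1 + d) / d)%R; split; [lra|].
  split; [apply Rdiv_lt_0_compat; lra|]; intros k w Hw.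
  set (K := (((1 + d) / d) ^ k * INR (fact k))%R).
  assert (Hb : forall n, (Cmod (tder k a n * w ^ n)
              <= K * Cmod (a n * RtoC ((1 + d) * r)%R ^ n))%R).
  { intros n; unfold tder.
    rewrite !Cmod_mult, !Cmod_pow, !Cmod_R, (Rabs_pos_eq ((1 + d) * r)) by lra.
    assert (H1 := ffact_rising k n); assert (H2 := rising_bound d n k (Rlt_le _ _ Hd)).
    assert (Hdk : (0 < d ^ k)%R) by (now apply pow_lt).
    assert (H3 : (rising n k <= K * (1 + d) ^ n)%R).
    { apply Rmult_le_reg_r with (d ^ k)%R; [easy|].
      eapply Rle_trans; [exact H2|apply Req_le].
      unfold K, Rdiv; rewrite Rpow_mult_distr, pow_inv, pow_add; field; lra. }
    assert (H4 : (Cmod w ^ n <= r ^ n)%R)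
      by (apply pow_incr; split; [apply Cmod_ge_0|easy]).
    rewrite Rpow_mult_distr.
    replace (K * (Cmod (a n) * ((1 + d) ^ n * r ^ n)))%R
      with (K * (1 + d) ^ n * Cmod (a n) * r ^ n)%R by ring.
    apply Rmult_le_compat; try easy.
    - apply Rmult_le_pos; [apply Rabs_pos|apply Cmod_ge_0].
    - apply pow_le, Cmod_ge_0.
    - apply Rmult_le_compat_r; [apply Cmod_ge_0|lra]. }
  assert (Hsum := ex_series_scal (V := R_NormedModule) K _ Hac).
  assert (Hw' : (Cmod w < rho)%R) by lra.
  eapply Rle_trans.
  { apply Cmod_CSeries, (conv_absconv rho); [now apply conv_tder|easy]. }
  replace (2 * T * ((1 + d) / d) ^ k * INR (fact k))%R with (2 * (K * T))%R
    by (unfold K; ring).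
  apply Rmult_le_compat_l; [lra|]; unfold T; rewrite <- Series_scal_l.
  apply Series_le; [|exact Hsum].
  intros n; split; [apply Cmod_ge_0|apply Hb].
Qed.

Lemma Cderiv_real f b x l :
  Cderiv f (b + RtoC x) l ->
  is_derive (fun s : R => fst (f (b + RtoC s))) x (fst l).
Proof.
  intros H; apply is_derive_Reals; intros eps He.
  destruct (H (eps / 2)%R) as (d & Hd & HH); [lra|].
  exists (mkposreal d Hd); intros h Hh Hhd; simpl in Hhd.
  specialize (HH (b + RtoC (x + h))).
  replace (b + RtoC (x + h) - (b + RtoC x)) with (RtoC h) in HH
    by (rewrite RtoC_plus; ring).
  rewrite Cmod_R in HH; specialize (HH Hhd).
  assert (Hh0 : (0 < Rabs h)%R) by (now apply Rabs_pos_lt).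
  apply Rle_lt_trans with (eps / 2)%R; [|lra].
  apply Rmult_le_reg_r with (Rabs h); [easy|].
  rewrite <- Rabs_mult; eapply Rle_trans; [|exact HH].
  eapply Rle_trans; [|apply Rabs_fst_le]; apply Req_le; f_equal.
  simpl; field; easy.
Qed.

Section Taylor.
Local Open Scope R_scope.

Lemma taylor_series (g : nat -> R -> R) (c r M A : R) :
  0 < r -> 0 <= M -> 0 < A ->
  (forall k s, Rabs (s - c) < r -> is_derive (g k) s (g (S k) s)) ->
  (forall k s, Rabs (s - c) < r -> Rabs (g k s) <= M * A ^ k * INR (fact k)) ->
  forall h, Rabs h < r -> A * Rabs h < 1 ->
    is_pseries (fun k => g k c / INR (fact k)) h (g O (c + h)).
Proof.
  intros Hr HM HA Hg Hb h Hh HAh.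
  (* [psi N] joins the [N]-th Taylor sum at [c] (for [t = 0]) to [g 0 (c + h)]
     (for [t = 1]), and its derivative telescopes. *)
  pose (psi := fix psi (N : nat) (t : R) : R :=
    match N with
    | O => g O (c + t * h)
    | S n => psi n t + g (S n) (c + t * h) * ((1 - t) * h) ^ S n / INR (fact (S n))
    end).
  assert (Hin : forall t, 0 <= t <= 1 -> Rabs (c + t * h - c) < r).
  { intros t Ht; replace (c + t * h - c) with (t * h) by ring.
    rewrite Rabs_mult, Rabs_pos_eq by lra.
    generalize (Rabs_pos h); nra. }
  assert (Hd0 : forall k t, 0 <= t <= 1 ->
     is_derive (fun t => g k (c + t * h)) t (h * g (S k) (c + t * h))).
  { intros k t Ht.
    assert (D : is_derive (fun t => c + t * h) t h)
      by (auto_derive; [easy|ring]).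
    exact (is_derive_comp (g k) (fun t => c + t * h) t _ _ (Hg k _ (Hin t Ht)) D). }
  assert (Hfact : forall n, INR (fact n) <> 0) by (intros n; apply INR_fact_neq_0).
  assert (Hd : forall N t, 0 <= t <= 1 ->
     is_derive (psi N) t (g (S N) (c + t * h) * ((1 - t) * h) ^ N * h / INR (fact N))).
  { induction N as [|N IH]; intros t Ht.
    - simpl; replace (_ / 1) with (h * g 1%nat (c + t * h)) by field.
      now apply Hd0.
    - assert (DP : is_derive (fun t => ((1 - t) * h) ^ S N / INR (fact (S N))) t
          (- h * ((1 - t) * h) ^ N / INR (fact N))).
      { assert (E : INR (fact (S N)) = INR (S N) * INR (fact N))
          by (now rewrite fact_simpl, mult_INR).
        auto_derive; [easy|].
        change (match N with O => 1 | S _ => INR N + 1 end) with (INR (S N)).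
        change (fact N + N * fact N)%nat with (fact (S N)).
        change (1 + - t) with (1 - t); rewrite E; field; split; auto; apply not_0_INR; lia. }
      assert (DM := is_derive_mult _ _ t _ _ (Hd0 (S N) t Ht) DP Rmult_comm).
      assert (DS := is_derive_plus _ _ t _ _ (IH t Ht) DM).
      eapply is_derive_ext.
      2: match type of DS with is_derive _ _ ?l =>
           replace (g (S (S N)) (c + t * h) * ((1 - t) * h) ^ S N * h / INR (fact (S N)))
             with l; [exact DS|] end.
      + intros s; unfold plus, mult; simpl; unfold Rdiv; ring.
      + unfold plus, mult; simpl AbelianMonoid.plus; cbv beta.
        simpl; change (fact N + N * fact N)%nat with (fact (S N)).
        field; auto. }
  (* Only the last term of the telescoping derivative is left, and the mean value theorem applies to
     it. The factor [N + 1] is the quotient of the factorials in the bound for [g (S N)] and in the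
     denominator. *)
  assert (Hrem : forall N, Rabs (psi N 1 - psi N 0)
            <= M * A * Rabs h * (INR (S N) * (A * Rabs h) ^ N)).
  { intros N.
    destruct (MVT_gen (psi N) 0 1
       (fun t => g (S N) (c + t * h) * ((1 - t) * h) ^ N * h / INR (fact N)))
      as (t & Ht & He).
    - rewrite Rmin_left, Rmax_right by lra; intros t Ht; apply Hd; lra.
    - rewrite Rmin_left, Rmax_right by lra; intros t Ht.
      apply continuity_pt_filterlim.
      apply (ex_derive_continuous (V := R_NormedModule)).
      eexists; apply Hd; lra.
    - rewrite Rmin_left, Rmax_right in Ht by lra.
      rewrite He, Rminus_0_r, Rmult_1_r.
      rewrite Rabs_div, !Rabs_mult, <- RPow_abs, Rabs_mult by auto.
      rewrite (Rabs_pos_eq (INR _)) by apply pos_INR.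
      assert (Hf : 0 < INR (fact N)) by (apply INR_fact_lt_0).
      apply Rle_div_l; [easy|].
      assert (HG := Hb (S N) _ (Hin t Ht)).
      rewrite fact_simpl, mult_INR in HG.
      assert (HP : (Rabs (1 - t) * Rabs h) ^ N <= Rabs h ^ N).
      { apply pow_incr; split; [apply Rmult_le_pos; apply Rabs_pos|].
        rewrite (Rabs_pos_eq (1 - t)) by lra; generalize (Rabs_pos h); nra. }
      assert (HQ : Rabs (g (S N) (c + t * h)) * (Rabs (1 - t) * Rabs h) ^ N
         <= M * A ^ S N * (INR (S N) * INR (fact N)) * Rabs h ^ N).
      { apply Rmult_le_compat; auto using Rabs_pos.
        apply pow_le, Rmult_le_pos; apply Rabs_pos. }
      apply (Rmult_le_compat_r (Rabs h)) in HQ; [|apply Rabs_pos].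
      eapply Rle_trans; [exact HQ|apply Req_le].
      rewrite Rpow_mult_distr; simpl pow; ring. }
  assert (H1 : forall N, psi N 1 = g O (c + h)).
  { induction N as [|N IH]; simpl; [now rewrite Rmult_1_l|].
    rewrite IH; unfold Rdiv; ring. }
  assert (H0 : forall N, psi N 0 = sum_n (fun k => scal (pow_n h k) (g k c / INR (fact k))) N).
  { induction N as [|N IH].
    - rewrite sum_O; simpl; rewrite Rmult_0_l, Rplus_0_r.
      unfold scal, one; simpl; unfold mult; simpl; field.
    - rewrite sum_Sn, <- IH, pow_n_pow.
      change (psi (S N) 0) with (psi N 0 + g (S N) (c + 0 * h)
         * ((1 - 0) * h) ^ S N / INR (fact (S N))).
      rewrite Rmult_0_l, Rplus_0_r, Rminus_0_r, Rmult_1_l.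
      unfold plus, scal; simpl AbelianMonoid.plus; unfold mult; simpl; unfold Rdiv; ring. }
  set (q := A * Rabs h) in *.
  assert (Hq : 0 <= q < 1).
  { split; [|easy]; apply Rmult_le_pos; [lra|apply Rabs_pos]. }
  assert (Hlim : is_lim_seq (fun N => INR (S N) * q ^ N) 0).
  { set (s := sqrt q).
    assert (Hs : 0 <= s < 1).
    { split; [apply sqrt_pos|]; unfold s; rewrite <- sqrt_1; apply sqrt_lt_1; lra. }
    assert (Hss : s * s = q) by (apply sqrt_sqrt; lra).
    apply (is_lim_seq_le_le (fun _ => 0) _ (fun N => / (1 - s) * s ^ N)).
    - intros N; split.
      + apply Rmult_le_pos; [apply pos_INR|apply pow_le; lra].
      + rewrite <- Hss, Rpow_mult_distr, <- Rmult_assoc.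
        apply Rmult_le_compat_r; [apply pow_le; lra|].
        assert (Hb2 := S_pow_bound s N Hs).
        assert (0 <= s ^ S N) by (apply pow_le; lra).
        apply Rmult_le_reg_r with (1 - s); [lra|]; rewrite Rinv_l; lra.
    - apply is_lim_seq_const.
    - replace (Finite 0) with (Rbar_mult (/ (1 - s)) 0)
        by (simpl; f_equal; ring).
      apply is_lim_seq_scal_l, is_lim_seq_geom; rewrite Rabs_pos_eq; lra. }
  change (is_lim_seq (sum_n (fun k => scal (pow_n h k) (g k c / INR (fact k))))
            (g O (c + h))).
  apply is_lim_seq_ext with (u := fun N => g O (c + h) - (psi N 1 - psi N 0)).
  { intros N; rewrite H1, H0; ring. }
  replace (Finite (g O (c + h))) with (Finite (g O (c + h) - 0))
    by (f_equal; ring).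
  apply is_lim_seq_minus'; [apply is_lim_seq_const|].
  apply is_lim_seq_abs_0.
  apply (is_lim_seq_le_le (fun _ => 0) _
           (fun N => M * A * Rabs h * (INR (S N) * q ^ N))).
  - intros N; split; [apply Rabs_pos|apply Hrem].
  - apply is_lim_seq_const.
  - replace (Finite 0) with (Rbar_mult (M * A * Rabs h) 0)
      by (simpl; f_equal; ring).
    now apply is_lim_seq_scal_l.
Qed.

End Taylor.

(** * Continuation inside a disc *)

Lemma continuous_C {U : UniformSpace} (f : U -> C) (x : U) :
  continuous (fun u => fst (f u)) x -> continuous (fun u => snd (f u)) x ->
  continuous f x.
Proof.
  intros H1 H2; apply filterlim_locally; intros eps.
  assert (F1 := proj1 (filterlim_locally _ _) H1 eps).
  assert (F2 := proj1 (filterlim_locally _ _) H2 eps).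
  generalize (filter_and _ _ F1 F2); apply filter_imp; intros u [B1 B2].
  split; assumption.
Qed.

Lemma continuous_Cfst {U : UniformSpace} (f : U -> C) (x : U) :
  continuous f x -> continuous (fun u => fst (f u)) x.
Proof.
  intros H; apply filterlim_locally; intros eps.
  generalize (proj1 (filterlim_locally _ _) H eps); apply filter_imp.
  intros u B; exact (proj1 B).
Qed.

Lemma continuous_Csnd {U : UniformSpace} (f : U -> C) (x : U) :
  continuous f x -> continuous (fun u => snd (f u)) x.
Proof.
  intros H; apply filterlim_locally; intros eps.
  generalize (proj1 (filterlim_locally _ _) H eps); apply filter_imp.
  intros u B; exact (proj2 B).
Qed.

Lemma continuous_Rplus {U : UniformSpace} (f g : U -> R) x :
  continuous f x -> continuous g x -> continuous (fun u => (f u + g u)%R) x.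
Proof. exact (continuous_plus (V := R_NormedModule) f g x). Qed.

Lemma continuous_Rmult {U : UniformSpace} (f g : U -> R) x :
  continuous f x -> continuous g x -> continuous (fun u => (f u * g u)%R) x.
Proof. exact (continuous_mult (K := R_AbsRing) f g x). Qed.

Lemma segment_continuous x y s : continuous (segment x y) s.
Proof.
  unfold segment; apply continuous_C.
  - apply (continuous_ext (fun u : R => (fst x + u * (fst y - fst x))%R)).
    { intros u; simpl; ring. }
    apply continuous_Rplus; [apply continuous_const|].
    apply continuous_Rmult; [apply continuous_id|apply continuous_const].
  - apply (continuous_ext (fun u : R => (snd x + u * (snd y - snd x))%R)).
    { intros u; simpl; ring. }
    apply continuous_Rplus; [apply continuous_const|].
    apply continuous_Rmult; [apply continuous_id|apply continuous_const].
Qed.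

Lemma concat_segments_continuous x y z s :
  continuous (concat (segment x y) (segment y z)) s.
Proof.
  (* [min(2s,1)] and [max(2s-1,0)] in terms of absolute values *)
  pose (p := fun s : R => ((2 * s + 1 - Rabs (2 * s - 1)) / 2)%R).
  pose (q := fun s : R => ((2 * s - 1 + Rabs (2 * s - 1)) / 2)%R).
  apply (continuous_ext (fun s =>
           x + RtoC (p s) * (y - x) + RtoC (q s) * (z - y))).
  { intros u; unfold concat, segment, p, q.
    match goal with |- ?l = ?r => change (@eq C l r) end.
    destruct Rle_dec as [H|H].
    - rewrite Rabs_left1 by lra.
      replace ((2 * u + 1 - - (2 * u - 1)) / 2)%R with (2 * u)%R by field.
      replace ((2 * u - 1 + - (2 * u - 1)) / 2)%R with 0%R by field; ring.
    - rewrite Rabs_pos_eq by lra.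
      replace ((2 * u + 1 - (2 * u - 1)) / 2)%R with 1%R by field.
      replace ((2 * u - 1 + (2 * u - 1)) / 2)%R with (2 * u - 1)%R by field; ring. }
  assert (Ha : continuous (fun s : R => Rabs (2 * s - 1)) s).
  { apply continuous_Rabs_comp, continuous_Rplus; [|apply continuous_const].
    apply continuous_Rmult; [apply continuous_const|apply continuous_id]. }
  assert (Hp : continuous p s).
  { apply continuous_Rmult; [|apply continuous_const].
    apply continuous_Rplus.
    - apply continuous_Rplus; [|apply continuous_const].
      apply continuous_Rmult; [apply continuous_const|apply continuous_id].
    - now apply (continuous_opp (V := R_NormedModule)). }
  assert (Hq : continuous q s).
  { apply continuous_Rmult; [|apply continuous_const].
    apply continuous_Rplus; [|exact Ha].
    apply continuous_Rplus; [|apply continuous_const].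
    apply continuous_Rmult; [apply continuous_const|apply continuous_id]. }
  apply continuous_C.
  - apply (continuous_ext (fun s => (fst x + p s * (fst y - fst x)
                                     + q s * (fst z - fst y))%R)).
    { intros u; simpl; ring. }
    repeat first [ assumption | simple apply continuous_const
                 | simple apply continuous_Rplus | simple apply continuous_Rmult ].
  - apply (continuous_ext (fun s => (snd x + p s * (snd y - snd x)
                                     + q s * (snd z - snd y))%R)).
    { intros u; simpl; ring. }
    repeat first [ assumption | simple apply continuous_const
                 | simple apply continuous_Rplus | simple apply continuous_Rmult ].
Qed.

Lemma ball_convex (b x y : C) (d s : R) :
  (Cmod (x - b) < d)%R -> (Cmod (y - b) < d)%R -> (0 <= s <= 1)%R ->
  (Cmod (x + RtoC s * (y - x) - b) < d)%R.
Proof.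
  intros Hx Hy Hs.
  replace (x + RtoC s * (y - x) - b)
    with (RtoC (1 - s)%R * (x - b) + RtoC s * (y - b))
    by (rewrite RtoC_minus; ring).
  eapply Rle_lt_trans; [apply Cmod_triangle|].
  rewrite !Cmod_mult, !Cmod_R, !Rabs_pos_eq by lra.
  destruct (Req_dec s 0) as [->|H0]; [lra|].
  nra.
Qed.

Section Disc.
Variables (X : C -> Prop) (b : C) (d : R).
Hypothesis disc : forall z, (Cmod (z - b) < d)%R -> X z.

Lemma segment_is_path x y :
  (Cmod (x - b) < d)%R -> (Cmod (y - b) < d)%R -> is_path X x y (segment x y).
Proof.
  intros Hx Hy; split; [apply segment_continuous|].
  unfold segment; split; [ring|split; [ring|]].
  intros s Hs; apply disc; now apply ball_convex.
Qed.

Lemma concat_segments_disc x y z s :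
  (Cmod (x - b) < d)%R -> (Cmod (y - b) < d)%R -> (Cmod (z - b) < d)%R ->
  (0 <= s <= 1)%R ->
  (Cmod (concat (segment x y) (segment y z) s - b) < d)%R.
Proof.
  intros Hx Hy Hz Hs; unfold concat, segment; destruct Rle_dec;
    apply ball_convex; (assumption || lra).
Qed.

Lemma concat_segments_is_path x y z :
  (Cmod (x - b) < d)%R -> (Cmod (y - b) < d)%R -> (Cmod (z - b) < d)%R ->
  is_path X x z (concat (segment x y) (segment y z)).
Proof.
  intros Hx Hy Hz; split; [intros s; apply concat_segments_continuous|].
  split; [|split].
  - unfold concat, segment; destruct Rle_dec; [|lra].
    rewrite Rmult_0_r; ring.
  - unfold concat, segment; destruct Rle_dec; [lra|].
    replace (2 * 1 - 1)%R with 1%R by ring; ring.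
  - intros s Hs; apply disc; now apply concat_segments_disc.
Qed.

Lemma linear_homotopy x z (g h : R -> C) :
  is_path (fun w => (Cmod (w - b) < d)%R) x z g ->
  is_path (fun w => (Cmod (w - b) < d)%R) x z h ->
  homotopic X x z g h.
Proof.
  intros (Cg & Hg0 & Hg1 & Dg) (Ch & Hh0 & Hh1 & Dh).
  exists (fun p => g (fst p) + RtoC (snd p) * (h (fst p) - g (fst p))).
  split; [|split; [|split]].
  - intros [s u].
    assert (Fg : continuous (fun p : R * R => g (fst p)) (s, u))
      by (apply (continuous_comp fst g); [apply continuous_fst|apply Cg]).
    assert (Fh : continuous (fun p : R * R => h (fst p)) (s, u))
      by (apply (continuous_comp fst h); [apply continuous_fst|apply Ch]).
    assert (Fu : continuous (fun p : R * R => snd p) (s, u))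
      by apply continuous_snd.
    assert (G1 := continuous_Cfst _ _ Fg); assert (G2 := continuous_Csnd _ _ Fg).
    assert (H1 := continuous_Cfst _ _ Fh); assert (H2 := continuous_Csnd _ _ Fh).
    apply continuous_C.
    + apply (continuous_ext (fun p : R * R =>
         (fst (g (fst p)) + snd p * (fst (h (fst p)) + (-1) * fst (g (fst p))))%R)).
      { intros p; simpl; ring. }
      repeat first [ assumption | simple apply continuous_const
                 | simple apply continuous_Rplus | simple apply continuous_Rmult ].
    + apply (continuous_ext (fun p : R * R =>
         (snd (g (fst p)) + snd p * (snd (h (fst p)) + (-1) * snd (g (fst p))))%R)).
      { intros p; simpl; ring. }
      repeat first [ assumption | simple apply continuous_const
                 | simple apply continuous_Rplus | simple apply continuous_Rmult ].
  - intros s u Hs Hu; apply disc; apply ball_convex; auto.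
  - intros s _; simpl; split; ring.
  - intros u _; simpl; rewrite Hg0, Hg1, Hh0, Hh1; split; ring.
Qed.

End Disc.

(** Makes the function of paths [F] a function of the end point over the disc, so that its
    expansions at different centres can be compared. *)
Lemma germ_on_disc (X : C -> Prop) (b t0 : C) (d : R) (F : (R -> C) -> C) :
  (forall z, (Cmod (z - b) < d)%R -> X z) ->
  (forall y g h, is_path X t0 y g -> is_path X t0 y h -> homotopic X t0 y g h ->
     F g = F h) ->
  (Cmod (t0 - b) < d)%R ->
  forall y z, (Cmod (y - b) < d)%R -> (Cmod (z - b) < d)%R ->
    F (concat (segment t0 y) (segment y z)) = F (segment t0 z).
Proof.
  intros Hd HF Ht y z Hy Hz; apply (HF z).
  - now apply (concat_segments_is_path X b d).
  - now apply (segment_is_path X b d).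
  - apply (linear_homotopy X b d); auto.
    + now apply (concat_segments_is_path _ b d).
    + now apply (segment_is_path _ b d).
Qed.

Lemma is_pseries_fst (u : nat -> C) (h : R) (l : C) :
  is_pseries (K := C_AbsRing) (V := C_NormedModule) u (RtoC h) l ->
  is_pseries (fun k => fst (u k)) h (fst l).
Proof.
  intros H; unfold is_pseries, is_series in *.
  assert (Hp : forall k, pow_n (K := C_AbsRing) (RtoC h) k = RtoC (h ^ k)).
  { induction k as [|k IH]; [reflexivity|].
    change (pow_n (K := C_AbsRing) (RtoC h) (S k))
      with (RtoC h * pow_n (K := C_AbsRing) (RtoC h) k).
    now rewrite IH, <- RtoC_mult. }
  assert (Hs : forall N, sum_n (fun k => scal (pow_n h k) (fst (u k))) N
     = fst (sum_n (fun k => scal (V := C_NormedModule) (pow_n (K := C_AbsRing) (RtoC h) k) (u k)) N)).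
  { induction N as [|N IH].
    - rewrite !sum_O, Hp, pow_n_pow; unfold scal; simpl; unfold mult; simpl; ring.
    - rewrite !sum_Sn, IH, Hp, pow_n_pow; unfold scal, plus; simpl; unfold mult; simpl.
      ring. }
  apply filterlim_locally; intros eps.
  generalize (proj1 (filterlim_locally _ _) H eps); apply filter_imp.
  intros N B; rewrite Hs; exact (proj1 B).
Qed.

(** The increment [h] and its powers are real, so real parts of a Laurent expansion form a real one.
    The centre [s = 0] is included. *)
Lemma real_laurent (X : C -> Prop) (b t0 : C) (d : R) (F : (R -> C) -> C) :
  (forall z, (Cmod (z - b) < d)%R -> X z) ->
  (forall y g h, is_path X t0 y g -> is_path X t0 y h -> homotopic X t0 y g h ->
     F g = F h) ->
  (forall y g, is_path X t0 y g ->
     meromorphic_at (fun z => F (concat g (segment y z))) y) ->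
  (Cmod (t0 - b) < d)%R ->
  forall s, (Rabs s < d)%R ->
    exists (r : R) (n : nat) (u : nat -> R), (0 < r)%R /\
      forall h, (0 < Rabs h < r)%R ->
        is_pseries u h (h ^ n * fst (F (segment t0 (b + RtoC (s + h)%R))))%R.
Proof.
  intros Hd HF HM Ht s Hs.
  assert (Hy : (Cmod (b + RtoC s - b) < d)%R)
    by (replace (b + RtoC s - b) with (RtoC s) by ring; now rewrite Cmod_R).
  destruct (HM (b + RtoC s) (segment t0 (b + RtoC s)))
    as (r & n & u & Hr & Hu); [now apply (segment_is_path X b d)|].
  exists (Rmin r (d - Rabs s)), n, (fun k => fst (u k)); split.
  { apply Rmin_pos; lra. }
  intros h [Hh0 Hh].
  assert (Hh1 := Rlt_le_trans _ _ _ Hh (Rmin_l _ _)).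
  assert (Hh2 := Rlt_le_trans _ _ _ Hh (Rmin_r _ _)).
  assert (Hz : (Cmod (b + RtoC (s + h) - b) < d)%R).
  { replace (b + RtoC (s + h) - b) with (RtoC (s + h)) by ring; rewrite Cmod_R.
    generalize (Rabs_triang s h); lra. }
  specialize (Hu (b + RtoC (s + h))).
  replace (b + RtoC (s + h) - (b + RtoC s)) with (RtoC h) in Hu
    by (rewrite RtoC_plus; ring).
  rewrite Cmod_R in Hu; specialize (Hu (conj Hh0 Hh1)).
  rewrite (germ_on_disc X b t0 d F) in Hu by assumption.
  apply is_pseries_fst in Hu.
  rewrite <- RtoC_pow in Hu.
  match type of Hu with is_pseries _ _ ?l => match goal with |- is_pseries _ _ ?m =>
    replace m with l; [exact Hu|] end end.
  simpl; ring.
Qed.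

(** * Identity principle on a real segment *)

Section RealAnalytic.
Local Open Scope R_scope.

Lemma CV_radius_ge (a : nat -> R) (x : R) :
  ex_pseries a x -> Rbar_le (Rabs x) (CV_radius a).
Proof.
  intros H; apply Rbar_not_lt_le; intros Hlt; apply (CV_disk_outside _ _ Hlt).
  apply ex_pseries_R in H; now apply ex_series_lim_0.
Qed.

(** Convergence at the midpoint of [|h|] and [r] suffices; this covers [h = 0], where nothing is
    assumed. *)
Lemma CV_radius_gt (a : nat -> R) (r : R) (f : R -> R) :
  0 < r -> (forall h, 0 < Rabs h < r -> is_pseries a h (f h)) ->
  forall h, Rabs h < r -> Rbar_lt (Rabs h) (CV_radius a).
Proof.
  intros Hr H h Hh; set (k := (Rabs h + r) / 2).
  assert (Hk : Rabs h < k < r) by (unfold k; lra).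
  assert (Hk0 : 0 <= Rabs h) by apply Rabs_pos.
  assert (HK : Rabs k = k) by (apply Rabs_pos_eq; lra).
  eapply Rbar_lt_le_trans; [|apply (CV_radius_ge a k)].
  - simpl; lra.
  - exists (f k); apply H; lra.
Qed.

Lemma continuous_nonzero (f : R -> R) (x : R) :
  continuous f x -> f x <> 0 ->
  exists e, 0 < e /\ forall y, Rabs (y - x) < e -> f y <> 0.
Proof.
  intros Hc H0; assert (Hp : 0 < Rabs (f x)) by (now apply Rabs_pos_lt).
  destruct (proj1 (filterlim_locally f (f x)) Hc (mkposreal _ Hp)) as [e He].
  exists e; split; [apply cond_pos|]; intros y Hy Hf.
  specialize (He y Hy); unfold ball in He; simpl in He.
  unfold AbsRing_ball, abs, minus, plus, opp in He; simpl in He.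
  rewrite Hf, Rplus_0_l, Rabs_Ropp in He; lra.
Qed.

Lemma continuous_PSeries (a : nat -> R) (x : R) :
  Rbar_lt (Rabs x) (CV_radius a) -> continuous (PSeries a) x.
Proof. intros H; apply continuity_pt_filterlim; now apply PSeries_continuity. Qed.

(** If some coefficient is nonzero, dividing by [h] as long as the constant term vanishes leads to a
    series that is nonzero at 0, hence nearby by continuity. *)
Lemma isolated_zeros (v : nat -> R) (r : R) (f : R -> R) :
  0 < r -> (forall h, 0 < Rabs h < r -> is_pseries v h (f h)) ->
  (exists e, 0 < e /\ forall h, 0 < Rabs h < e -> f h = 0) \/
  (exists e, 0 < e /\ forall h, 0 < Rabs h < e -> f h <> 0).
Proof.
  intros Hr Hf; destruct (classic (forall k, v k = 0)) as [H0|H0].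
  - left; exists r; split; [easy|]; intros h Hh.
    rewrite <- (is_pseries_unique _ _ _ (Hf h Hh)).
    unfold PSeries; apply Series_eq0; intros n; rewrite H0; ring.
  - right; apply not_all_ex_not in H0; destruct H0 as [k Hk].
    revert v f Hf Hk; induction k as [|k IH]; intros v f Hf Hk.
    + destruct (continuous_nonzero (PSeries v) 0) as (e & He & H).
      * apply continuous_PSeries, (CV_radius_gt v r f Hr Hf); now rewrite Rabs_R0.
      * now rewrite PSeries_0.
      * exists (Rmin e r); split; [now apply Rmin_pos|]; intros h [Hh0 Hh].
        rewrite <- (is_pseries_unique _ _ _ (Hf h (conj Hh0 (Rlt_le_trans _ _ _ Hh (Rmin_r _ _))))).
        apply H; rewrite Rminus_0_r; exact (Rlt_le_trans _ _ _ Hh (Rmin_l _ _)).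
    + destruct (Req_dec (v O) 0) as [Hv0|Hv0].
      * destruct (IH (PS_decr_1 v) (fun h => / h * (f h - v O))) as (e & He & H).
        -- intros h Hh.
           assert (h <> 0) by (intros ->; rewrite Rabs_R0 in Hh; lra).
           apply (is_pseries_decr_1 v h (/ h) (f h)); [|now apply Hf].
           unfold mult, one; simpl; field; easy.
        -- exact Hk.
        -- exists e; split; [easy|]; intros h Hh Hfh.
           apply (H h Hh); rewrite Hfh, Hv0; ring.
      * destruct (continuous_nonzero (PSeries v) 0) as (e & He & H).
        -- apply continuous_PSeries, (CV_radius_gt v r f Hr Hf); now rewrite Rabs_R0.
        -- now rewrite PSeries_0.
        -- exists (Rmin e r); split; [now apply Rmin_pos|]; intros h [Hh0 Hh].
           rewrite <- (is_pseries_unique _ _ _ (Hf h (conj Hh0 (Rlt_le_trans _ _ _ Hh (Rmin_r _ _))))).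
           apply H; rewrite Rminus_0_r; exact (Rlt_le_trans _ _ _ Hh (Rmin_l _ _)).
Qed.

(** Punctured, because the value of the extension at the centre of a Laurent expansion is
    arbitrary. *)
Definition agree_near (f g : R -> R) (s : R) : Prop :=
  exists e, 0 < e /\ forall t, 0 < Rabs (t - s) < e -> f t = g t.

Definition differ_near (f g : R -> R) (s : R) : Prop :=
  exists e, 0 < e /\ forall t, 0 < Rabs (t - s) < e -> f t <> g t.

Lemma agree_or_differ_near (f g : R -> R) (s r : R) (n : nat) (u v : nat -> R) :
  0 < r ->
  (forall h, 0 < Rabs h < r -> is_pseries u h (h ^ n * f (s + h))) ->
  (forall h, 0 < Rabs h < r -> is_pseries v h (g (s + h))) ->
  agree_near f g s \/ differ_near f g s.
Proof.
  intros Hr Hu Hv.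
  assert (Hne : forall h, 0 < Rabs h -> h <> 0)
    by (intros h H ->; rewrite Rabs_R0 in H; lra).
  destruct (isolated_zeros (PS_minus u (PS_incr_n v n)) r
              (fun h => h ^ n * f (s + h) - h ^ n * g (s + h)) Hr) as [H|H].
  - intros h Hh.
    assert (H1 := is_pseries_incr_n v n h _ (Hv h Hh)); rewrite pow_n_pow in H1.
    exact (is_pseries_minus _ _ _ _ _ (Hu h Hh) H1).
  - left; destruct H as (e & He & H); exists e; split; [easy|]; intros t Ht.
    specialize (H _ Ht); replace (s + (t - s)) with t in H by ring.
    apply Rmult_eq_reg_l with ((t - s) ^ n); [lra|].
    apply pow_nonzero, Hne; apply Ht.
  - right; destruct H as (e & He & H); exists e; split; [easy|]; intros t Ht Hfg.
    apply (H _ Ht); replace (s + (t - s)) with t by ring; rewrite Hfg; ring.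
Qed.

Lemma agree_differ_absurd f g s : agree_near f g s -> differ_near f g s -> False.
Proof.
  intros (e & He & H) (e' & He' & H').
  set (m := Rmin e e'); assert (Hm : 0 < m) by (now apply Rmin_pos).
  assert (m <= e) by apply Rmin_l; assert (m <= e') by apply Rmin_r.
  assert (Hd : 0 < Rabs (s + m / 2 - s) < m).
  { replace (s + m / 2 - s) with (m / 2) by ring; rewrite Rabs_pos_eq; lra. }
  apply (H' (s + m / 2)); [lra|apply H; lra].
Qed.

Lemma near_open (P : R -> Prop) s e t :
  (forall w, 0 < Rabs (w - s) < e -> P w) -> 0 < Rabs (t - s) < e ->
  exists e', 0 < e' /\ forall w, 0 < Rabs (w - t) < e' -> P w.
Proof.
  intros H Ht.
  exists (Rmin (Rabs (t - s)) (e - Rabs (t - s))); split; [apply Rmin_pos; lra|].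
  intros w [_ Hw].
  assert (H1 := Rlt_le_trans _ _ _ Hw (Rmin_l _ _)).
  assert (H2 := Rlt_le_trans _ _ _ Hw (Rmin_r _ _)).
  apply H; split.
  - assert (H3 := Rabs_triang (w - s) (t - w)).
    replace (w - s + (t - w)) with (t - s) in H3 by ring.
    rewrite (Rabs_minus_sym t w) in H3; lra.
  - assert (H3 := Rabs_triang (w - t) (t - s)).
    replace (w - t + (t - s)) with (w - s) in H3 by ring; lra.
Qed.

(* Both alternatives are open, so connectedness propagates agreement. *)
Lemma agreement_propagates (f g : R -> R) (s0 : R) :
  (forall s, 0 < s <= s0 -> agree_near f g s \/ differ_near f g s) ->
  agree_near f g s0 ->
  forall s, 0 < s <= s0 -> agree_near f g s.
Proof.
  intros Hdich H0 s1 Hs1; destruct (Hdich s1 Hs1) as [|Hn]; [easy|exfalso].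
  (* At the supremum [m] of [E], agreement would make [m - e] an upper bound, whereas difference
     would persist to the right of [m], or contradict [H0] if [m = s0]. *)
  pose (E := fun s => s1 <= s <= s0 /\ differ_near f g s).
  destruct (completeness E) as (m & Hub & Hlub).
  { exists s0; intros s [Hs _]; lra. }
  { exists s1; split; [lra|easy]. }
  assert (Hm1 : s1 <= m) by (apply Hub; split; [lra|easy]).
  assert (Hm0 : m <= s0) by (apply Hlub; intros s [Hs _]; lra).
  destruct (Hdich m) as [(e & He & H)|(e & He & H)]; [lra| |].
  - assert (HE : is_upper_bound E (m - e)).
    { intros s [Hs Hd]; destruct (Rle_lt_dec s (m - e)) as [|Hlt]; [easy|].
      exfalso; assert (Hsm : s <= m) by (now apply Hub; split).
      destruct (Req_dec s m) as [->|Hne].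
      - apply (agree_differ_absurd f g m); [|easy]; now exists e.
      - destruct (near_open _ _ _ s H) as (e' & He' & H').
        { rewrite Rabs_left; lra. }
        apply (agree_differ_absurd f g s); [|easy]; now exists e'. }
    assert (m <= m - e) by (now apply Hlub); lra.
  - destruct (Req_dec m s0) as [->|Hne].
    + apply (agree_differ_absurd f g s0); [easy|]; now exists e.
    + set (d := Rmin e (s0 - m)).
      assert (Hd : 0 < d) by (apply Rmin_pos; lra).
      assert (d <= e) by apply Rmin_l; assert (d <= s0 - m) by apply Rmin_r.
      assert (Hin : E (m + d / 2)).
      { split; [lra|].
        destruct (near_open _ _ _ (m + d / 2) H) as (e' & He' & H').
        { replace (m + d / 2 - m) with (d / 2) by ring; rewrite Rabs_pos_eq; lra. }
        now exists e'. }
      assert (m + d / 2 <= m) by (now apply Hub); lra.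
Qed.

Lemma continuous_zero_right (k : R -> R) (e : R) :
  0 < e -> continuous k 0 -> (forall x, 0 < x < e -> k x = 0) -> k 0 = 0.
Proof.
  intros He Hc H; apply NNPP; intros Hk.
  destruct (continuous_nonzero k 0 Hc Hk) as (d & Hd & Hd').
  set (m := Rmin e d); assert (Hm : 0 < m) by (now apply Rmin_pos).
  assert (m <= e) by apply Rmin_l; assert (m <= d) by apply Rmin_r.
  apply (Hd' (m / 2)); [rewrite Rminus_0_r, Rabs_pos_eq; lra|].
  apply H; lra.
Qed.

Lemma continuous_pow (n : nat) (x : R) : continuous (fun y : R => y ^ n) x.
Proof.
  induction n as [|n IH]; [apply continuous_const|].
  apply continuous_Rmult; [apply continuous_id|exact IH].
Qed.

(* A Laurent series in [x^3] has no term in [x^(3n+1)]. *)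
Lemma cube_series_no_linear_term (p u : nat -> R) (n : nat) (e : R) :
  0 < e -> Rbar_lt 0 (CV_radius p) -> Rbar_lt 0 (CV_radius u) ->
  (forall x, 0 < x < e -> (x ^ 3) ^ n * PSeries p x = PSeries u (x ^ 3)) ->
  p 1%nat = 0.
Proof.
  intros He Hp Hu.
  assert (Hcp : forall q : nat -> R, Rbar_lt 0 (CV_radius q) -> continuous (PSeries q) 0)
    by (intros q Hq; apply continuous_PSeries; now rewrite Rabs_R0).
  assert (Hc3 : forall q : nat -> R, Rbar_lt 0 (CV_radius q) ->
            continuous (fun x : R => PSeries q (x ^ 3)) 0).
  { intros q Hq; apply (continuous_comp (fun x : R => x ^ 3) (PSeries q));
      [apply continuous_pow|].
    replace (0 ^ 3) with 0 by ring; now apply Hcp. }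
  assert (Hdecr : forall q : nat -> R, Rbar_lt 0 (CV_radius q) -> exists d, 0 < d /\
            forall x, Rabs x < d -> PSeries q x = q O + x * PSeries (PS_decr_1 q) x).
  { intros q Hq.
    assert (Hex : exists d : R, 0 < d /\ Rbar_le d (CV_radius q)).
    { destruct (CV_radius q) as [c| |]; [exists c|exists 1|easy]; simpl in *; split; lra. }
    destruct Hex as (d & Hd & Hdq); exists d; split; [easy|]; intros x Hx.
    apply PSeries_decr_1, CV_radius_inside.
    eapply Rbar_lt_le_trans; [|exact Hdq]; exact Hx. }
  assert (Hp' : Rbar_lt 0 (CV_radius (PS_decr_1 p))) by (now rewrite CV_radius_decr_1).
  (* For [n > 0] the limit at 0 gives [u 0 = 0], and division by [x^3] lowers [n]. For [n = 0] the
     constant terms cancel; after division by [x] the right-hand side still has the factor [x^2], so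
     [p 1] is its limit 0. *)
  revert u Hu e He; induction n as [|n IH]; intros u Hu e He H;
    assert (Hu' : Rbar_lt 0 (CV_radius (PS_decr_1 u))) by (now rewrite CV_radius_decr_1);
    destruct (Hdecr u Hu) as (d & Hd & Hdu);
    assert (Hsmall : forall x, 0 < x < Rmin 1 d -> Rabs (x ^ 3) < d)
      by (intros x Hx; assert (Rmin 1 d <= 1) by apply Rmin_l;
          assert (Rmin 1 d <= d) by apply Rmin_r;
          rewrite Rabs_pos_eq by (apply pow_le; lra); simpl; nra).
  - destruct (Hdecr p Hp) as (d' & Hd' & Hdp).
    assert (H0 : p O - u O = 0).
    { replace (p O - u O) with (PSeries p 0 + -1 * PSeries u (0 ^ 3))
        by (replace (0 ^ 3) with 0 by ring; rewrite !PSeries_0; ring).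
      apply (continuous_zero_right (fun x => PSeries p x + -1 * PSeries u (x ^ 3)) e He).
      - apply continuous_Rplus; [now apply Hcp|].
        apply continuous_Rmult; [apply continuous_const|now apply Hc3].
      - intros x Hx; rewrite <- H by easy; simpl; ring. }
    replace (p 1%nat) with (PSeries (PS_decr_1 p) 0
        + -1 * (0 ^ 2 * PSeries (PS_decr_1 u) (0 ^ 3)))
      by (rewrite PSeries_0; unfold PS_decr_1 at 1; ring).
    set (m := Rmin (Rmin 1 d) (Rmin e d')).
    apply (continuous_zero_right (fun x => PSeries (PS_decr_1 p) x
        + -1 * (x ^ 2 * PSeries (PS_decr_1 u) (x ^ 3))) m).
    + unfold m; repeat apply Rmin_pos; lra.
    + apply continuous_Rplus; [now apply Hcp|].
      apply continuous_Rmult; [apply continuous_const|].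
      apply continuous_Rmult; [apply continuous_pow|now apply Hc3].
    + intros x [Hx0 Hx].
      assert (x < Rmin 1 d) by exact (Rlt_le_trans _ _ _ Hx (Rmin_l _ _)).
      assert (Hx2 : x < Rmin e d') by exact (Rlt_le_trans _ _ _ Hx (Rmin_r _ _)).
      assert (x < e) by exact (Rlt_le_trans _ _ _ Hx2 (Rmin_l _ _)).
      assert (x < d') by exact (Rlt_le_trans _ _ _ Hx2 (Rmin_r _ _)).
      assert (Hxe : (x ^ 3) ^ 0 * PSeries p x = PSeries u (x ^ 3)) by (apply H; lra).
      rewrite Hdu in Hxe by (apply Hsmall; lra).
      rewrite Hdp in Hxe by (rewrite Rabs_pos_eq; lra).
      apply Rmult_eq_reg_l with x; [|lra].
      simpl in *; lra.
  - assert (H0 : u O = 0).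
    { replace (u O) with (PSeries u (0 ^ 3) + -1 * ((0 ^ 3) ^ S n * PSeries p 0))
        by (replace (0 ^ 3) with 0 by ring; rewrite PSeries_0; simpl; ring).
      apply (continuous_zero_right
               (fun x => PSeries u (x ^ 3) + -1 * ((x ^ 3) ^ S n * PSeries p x)) e He).
      - apply continuous_Rplus; [now apply Hc3|].
        apply continuous_Rmult; [apply continuous_const|].
        apply continuous_Rmult; [|now apply Hcp].
        apply (continuous_comp (fun x : R => x ^ 3) (fun x : R => x ^ S n));
          apply continuous_pow.
      - intros x Hx; rewrite <- H by easy; ring. }
    apply (IH (PS_decr_1 u) Hu' (Rmin e (Rmin 1 d))); [repeat apply Rmin_pos; lra|].
    intros x [Hx0 Hx].
    assert (x < e) by exact (Rlt_le_trans _ _ _ Hx (Rmin_l _ _)).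
    assert (Hx1 : x < Rmin 1 d) by exact (Rlt_le_trans _ _ _ Hx (Rmin_r _ _)).
    assert (Hxe : (x ^ 3) ^ S n * PSeries p x = PSeries u (x ^ 3)) by (apply H; lra).
    rewrite Hdu, H0 in Hxe by (apply Hsmall; lra).
    apply Rmult_eq_reg_l with (x ^ 3); [|apply pow_nonzero; lra].
    change ((x ^ 3) ^ S n) with (x ^ 3 * (x ^ 3) ^ n) in Hxe; lra.
Qed.

End RealAnalytic.

(** * Failure of the Painleve property *)

Lemma Cmod_ccbrt_le (z : C) (r : R) :
  (0 < fst z)%R -> (0 <= r)%R -> (Cmod z <= r ^ 3)%R -> (Cmod (ccbrt z) <= r)%R.
Proof.
  intros Hz Hr H; destruct (ccbrt_spec z Hz) as [H3 _].
  rewrite <- H3, Cmod_pow in H.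
  destruct (Rle_lt_dec (Cmod (ccbrt z)) r) as [|Hlt]; [easy|exfalso].
  assert (r ^ 3 < Cmod (ccbrt z) ^ 3)%R; [|lra].
  set (c := Cmod (ccbrt z)) in *.
  assert (r * r <= c * c)%R by (apply Rmult_le_compat; lra).
  assert (r * r * r <= c * c * r)%R by (apply Rmult_le_compat_r; lra).
  assert (c * c * r < c * c * c)%R
    by (apply Rmult_lt_compat_l; [apply Rmult_lt_0_compat|]; lra).
  simpl; lra.
Qed.

Lemma sol_solves rho b a x :
  conv rho a -> cleared_lhs b a = fcst 0 -> (0 < x < rho)%R ->
  exists r, (0 < r)%R /\ solves_on_disc the_ode (b + RtoC (x ^ 3)) r (sol b a 0).
Proof.
  intros Ha HL Hx.
  assert (Hx3 : (0 < x ^ 3)%R) by (apply pow_lt; lra).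
  set (y := ((x + rho) / 2)%R); assert (Hy : (x < y < rho)%R) by (unfold y; lra).
  assert (Hxy : (x ^ 3 < y ^ 3)%R).
  { assert (x * x < y * y)%R by nra; simpl; nra. }
  (* The first radius keeps [z - b] in the right half-plane, the second keeps its cube root within
     modulus [y < rho]. *)
  exists (Rmin (x ^ 3) (y ^ 3 - x ^ 3)); split; [apply Rmin_pos; lra|].
  exists (sol b a); intros z Hz.
  assert (H1 := Rlt_le_trans _ _ _ Hz (Rmin_l _ _)).
  assert (H2 := Rlt_le_trans _ _ _ Hz (Rmin_r _ _)).
  assert (Hzb : z - b = RtoC (x ^ 3) + (z - (b + RtoC (x ^ 3)))) by ring.
  assert (Hpos : (0 < fst (z - b)%C)%R).
  { rewrite Hzb; assert (H := Rabs_fst_le (z - (b + RtoC (x ^ 3)))).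
    assert (H' : (Rabs (fst (z - (b + RtoC (x ^ 3)))%C) < x ^ 3)%R) by lra.
    apply Rabs_def2 in H'; simpl in *; lra. }
  assert (Hc : (Cmod (ccbrt (z - b)) < rho)%R).
  { apply Rle_lt_trans with y; [|lra]; apply Cmod_ccbrt_le; [easy|lra|].
    rewrite Hzb; eapply Rle_trans; [apply Cmod_triangle|].
    rewrite Cmod_R, Rabs_pos_eq; lra. }
  split; [reflexivity|split].
  - intros k; apply Cderiv_is_derive; now apply (sol_deriv rho).
  - now apply (sol_ode rho).
Qed.

Lemma sol_real_analytic rho b a s :
  conv rho a -> (0 < rho)%R -> (0 < s < rho ^ 3)%R ->
  exists (r : R) (v : nat -> R), (0 < r)%R /\
    forall h, (Rabs h < r)%R ->
      is_pseries v h (fst (sol b a 0 (b + RtoC (s + h)))).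
Proof.
  intros Ha Hrho Hs.
  (* The modulus of [ccbrt s] is the real cube root of [s]; [y] lies midway between it and [rho]. *)
  assert (Hy : exists y, (0 < y < rho)%R /\ (s < y ^ 3)%R).
  { set (c := Cmod (ccbrt (RtoC s))).
    destruct (ccbrt_spec (RtoC s) (proj1 Hs)) as [H3 _].
    assert (Hc3 : (c ^ 3 = s)%R).
    { unfold c; rewrite <- Cmod_pow, H3, Cmod_R, Rabs_pos_eq; lra. }
    assert (Hc : (c < rho)%R).
    { destruct (Rlt_le_dec c rho) as [|Hle]; [easy|exfalso].
      assert (rho ^ 3 <= c ^ 3)%R by (apply pow_incr; lra); lra. }
    assert (Hc0 : (0 <= c)%R) by apply Cmod_ge_0.
    exists ((c + rho) / 2)%R; split; [lra|].
    rewrite <- Hc3; set (y := ((c + rho) / 2)%R); assert (c < y)%R by (unfold y; lra).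
    assert (c * c < y * y)%R by nra; simpl; nra. }
  destruct Hy as (y & Hy & Hsy).
  destruct (ev_tder_bound rho a y Ha Hy) as (M & A & HM & HA & Hb).
  set (r := Rmin (s / 2) (y ^ 3 - s)).
  assert (Hr : (0 < r)%R) by (apply Rmin_pos; lra).
  assert (Hr1 : (r <= s / 2)%R) by apply Rmin_l.
  assert (Hr2 : (r <= y ^ 3 - s)%R) by apply Rmin_r.
  (* For [t > s / 2] the denominator [t^k] of the [k]-th derivative costs at most [(2 / s)^k]. *)
  set (B := (A * (2 / s))%R).
  assert (HB : (0 < B)%R)
    by (apply Rmult_lt_0_compat; [easy|apply Rdiv_lt_0_compat; lra]).
  assert (Hin : forall t, (Rabs (t - s) < r)%R ->
            (s / 2 < t)%R /\ (Cmod (ccbrt (RtoC t)) <= y)%R).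
  { intros t Ht; apply Rabs_def2 in Ht; split; [lra|].
    apply Cmod_ccbrt_le; [simpl; lra|lra|].
    rewrite Cmod_R, Rabs_pos_eq; lra. }
  assert (Hbt : forall t, b + RtoC t - b = RtoC t) by (intros t; ring).
  exists (Rmin r (/ B)),
    (fun k => (fst (sol b a k (b + RtoC s)) / INR (fact k))%R); split.
  { apply Rmin_pos; [easy|now apply Rinv_0_lt_compat]. }
  intros h Hh.
  apply (taylor_series (fun k t => fst (sol b a k (b + RtoC t))) s r M B Hr HM HB).
  - intros k t Ht; destruct (Hin t Ht) as [Ht1 Ht2].
    apply (Cderiv_real (sol b a k)), (sol_deriv rho); [easy| |]; rewrite Hbt;
      [simpl|]; lra.
  - intros k t Ht; destruct (Hin t Ht) as [Ht1 Ht2].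
    eapply Rle_trans; [apply Rabs_fst_le|].
    assert (Ht0 : RtoC t ^ k <> 0).
    { apply Cpow_nz; intros H; apply RtoC_inj in H; lra. }
    unfold sol; rewrite Hbt, Cmod_mult, Cmod_inv, Cmod_pow, Cmod_R, Rabs_pos_eq
      by (easy || lra).
    apply Rle_trans with (M * A ^ k * INR (fact k) * (2 / s) ^ k)%R.
    + apply Rmult_le_compat; [apply Cmod_ge_0| |now apply Hb|].
      * left; apply Rinv_0_lt_compat, pow_lt; lra.
      * rewrite <- pow_inv; apply pow_incr; split.
        -- left; apply Rinv_0_lt_compat; lra.
        -- replace (2 / s)%R with (/ (s / 2))%R by (field; lra).
           apply Rinv_le_contravar; lra.
    + apply Req_le; unfold B; rewrite Rpow_mult_distr; ring.
  - exact (Rlt_le_trans _ _ _ Hh (Rmin_l _ _)).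
  - assert (H := Rlt_le_trans _ _ _ Hh (Rmin_r _ _)).
    apply (Rmult_lt_compat_l B) in H; [|easy]; rewrite Rinv_r in H; lra.
Qed.

Lemma sol_on_cubes rho b a x :
  conv rho a -> (0 < x < rho)%R ->
  fst (sol b a 0 (b + RtoC (x ^ 3))) = PSeries (fun n => fst (a n)) x.
Proof.
  intros Ha Hx; unfold sol.
  replace (b + RtoC (x ^ 3) - b) with (RtoC (x ^ 3)) by ring.
  rewrite ccbrt_pow3 by lra.
  replace (tder 0 a) with a
    by (apply functional_extensionality; intros n; unfold tder; simpl; ring).
  replace (ev a x * / RtoC (x ^ 3) ^ 0) with (ev a x) by (simpl; field).
  unfold ev, CSeries, PSeries; simpl; apply Series_ext; intros n.
  rewrite <- RtoC_pow; simpl; ring.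
Qed.

Lemma conv_CV_radius rho a :
  conv rho a -> (0 < rho)%R -> Rbar_lt 0 (CV_radius (fun n => fst (a n))).
Proof.
  intros Ha Hrho; apply Rbar_lt_le_trans with (rho / 2)%R; [simpl; lra|].
  rewrite <- (Rabs_pos_eq (rho / 2)) by lra; apply CV_radius_ge, ex_pseries_R.
  assert (Hac : absconv (fun n => a n * RtoC (rho / 2) ^ n)).
  { apply (conv_absconv rho _ _ Ha); rewrite Cmod_R, Rabs_pos_eq; lra. }
  apply absconv_fst, ex_series_Rabs in Hac; revert Hac; apply ex_series_ext.
  intros n; rewrite <- RtoC_pow; simpl; ring.
Qed.

Lemma branch_not_extendable (X : C -> Prop) (b : C) (d rho : R) (a : fps) :
  (0 < d)%R -> (0 < rho)%R -> (forall z, (Cmod (z - b) < d)%R -> X z) ->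
  conv rho a -> fst (a 1%nat) <> 0%R ->
  exists x, (0 < x < rho)%R /\ (x ^ 3 < d)%R /\
    ~ extends_to_universal_covering X (b + RtoC (x ^ 3)) (sol b a 0).
Proof.
  intros Hd Hrho HX Ha Ha1.
  (* Being less than 1 as well as [d], [x0] satisfies [x0^3 < d]. *)
  set (x0 := (Rmin 1 (Rmin d rho) / 2)%R).
  assert (Hm : (0 < Rmin 1 (Rmin d rho))%R) by (repeat apply Rmin_pos; lra).
  assert (Hm1 : (Rmin 1 (Rmin d rho) <= 1)%R) by apply Rmin_l.
  assert (Hm2 : (Rmin 1 (Rmin d rho) <= Rmin d rho)%R) by apply Rmin_r.
  assert (Hm3 : (Rmin d rho <= d)%R) by apply Rmin_l.
  assert (Hm4 : (Rmin d rho <= rho)%R) by apply Rmin_r.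
  assert (Hx0 : (0 < x0 < rho)%R) by (unfold x0; lra).
  assert (Hx1 : (x0 < 1)%R) by (unfold x0; lra).
  assert (Hxd : (x0 < d)%R) by (unfold x0; lra).
  assert (Hx3 : (0 < x0 ^ 3)%R) by (apply pow_lt; lra).
  assert (Hx3d : (x0 ^ 3 < d)%R) by (simpl; nra).
  clearbody x0.
  assert (Hxr : (x0 ^ 3 < rho ^ 3)%R).
  { assert (x0 * x0 < rho * rho)%R by nra; simpl; nra. }
  exists x0; split; [easy|split; [easy|]].
  set (t0 := b + RtoC (x0 ^ 3)).
  intros (F & HF & HM & r0 & Hr0 & Hgerm).
  assert (Ht0 : (Cmod (t0 - b) < d)%R).
  { unfold t0; replace (b + RtoC (x0 ^ 3) - b) with (RtoC (x0 ^ 3)) by ring.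
    rewrite Cmod_R, Rabs_pos_eq; lra. }
  pose (f := fun t : R => fst (F (segment t0 (b + RtoC t)))).
  pose (g := fun t : R => fst (sol b a 0 (b + RtoC t))).
  assert (HL := real_laurent X b t0 d F HX HF HM Ht0).
  assert (Hag : forall s, (0 < s <= x0 ^ 3)%R -> agree_near f g s).
  { apply agreement_propagates.
    - intros s Hs.
      destruct (HL s) as (r & n & u & Hr & Hu); [rewrite Rabs_pos_eq; lra|].
      destruct (sol_real_analytic rho b a s Ha Hrho) as (r' & v & Hr' & Hv); [lra|].
      apply (agree_or_differ_near f g s (Rmin r r') n u v).
      + now apply Rmin_pos.
      + intros h [Hh0 Hh]; apply Hu; split; [easy|].
        exact (Rlt_le_trans _ _ _ Hh (Rmin_l _ _)).
      + intros h [Hh0 Hh]; apply Hv; exact (Rlt_le_trans _ _ _ Hh (Rmin_r _ _)).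
    - exists r0; split; [easy|]; intros t [_ Ht]; unfold f, g; rewrite Hgerm; [easy|].
      unfold t0; replace (b + RtoC t - (b + RtoC (x0 ^ 3))) with (RtoC (t - x0 ^ 3))
        by (rewrite RtoC_minus; ring).
      now rewrite Cmod_R. }
  destruct (HL 0%R) as (r & n & u & Hr & Hu); [rewrite Rabs_R0; lra|].
  assert (HCV := CV_radius_gt u r _ Hr Hu).
  (* Near [t] the functions [f] and [g] agree possibly except at [t]; the identity for [g] at
     neighbouring points passes to [t] because both of its sides are continuous. *)
  assert (Hgu : forall t, (0 < t < Rmin r (x0 ^ 3))%R ->
            (t ^ n * g t = PSeries u t)%R).
  { intros t [Ht0' Ht].
    assert (H1 := Rlt_le_trans _ _ _ Ht (Rmin_l _ _)).
    assert (H2 := Rlt_le_trans _ _ _ Ht (Rmin_r _ _)).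
    destruct (Hag t) as (e & He & Hfg); [lra|].
    apply Rminus_diag_uniq, NNPP; intros Hne.
    assert (Hcont : continuous (fun t : R => t ^ n * g t + -1 * PSeries u t)%R t).
    { apply continuous_Rplus; [apply continuous_Rmult|apply continuous_Rmult].
      - apply continuous_pow.
      - destruct (sol_real_analytic rho b a t Ha Hrho) as (r' & v & Hr' & Hv); [lra|].
        apply (continuous_ext_loc _ (fun w => PSeries v (w - t)%R) t).
        + exists (mkposreal r' Hr'); intros w Hw.
          change (Rabs (w - t) < r')%R in Hw.
          rewrite (is_pseries_unique _ _ _ (Hv _ Hw)).
          unfold g; repeat f_equal; ring.
        + apply (continuous_comp (fun w : R => (w - t)%R) (PSeries v)).
          * apply continuous_Rplus; [apply continuous_id|apply continuous_const].
          * apply continuous_PSeries, (CV_radius_gt v r'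
              (fun h => fst (sol b a 0 (b + RtoC (t + h))))); [easy| |].
            -- intros h [_ Hh]; now apply Hv.
            -- rewrite Rminus_diag, Rabs_R0; easy.
      - apply continuous_const.
      - apply continuous_PSeries, HCV; rewrite Rabs_pos_eq; lra. }
    destruct (continuous_nonzero _ t Hcont) as (e' & He' & Hnz).
    { intros H; apply Hne; lra. }
    set (m := Rmin (Rmin e e') (r - t)).
    assert (Hmp : (0 < m)%R) by (repeat apply Rmin_pos; lra).
    assert (Hma : (m <= Rmin e e')%R) by apply Rmin_l.
    assert (Hmb : (m <= r - t)%R) by apply Rmin_r.
    assert (Hmc : (Rmin e e' <= e)%R) by apply Rmin_l.
    assert (Hmd : (Rmin e e' <= e')%R) by apply Rmin_r.
    assert (Habs : Rabs (t + m / 2 - t) = (m / 2)%R).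
    { replace (t + m / 2 - t)%R with (m / 2)%R by ring; rewrite Rabs_pos_eq; lra. }
    apply (Hnz (t + m / 2)%R); [lra|].
    rewrite <- Hfg by lra.
    rewrite (is_pseries_unique _ _ _ (Hu (t + m / 2)%R ltac:(rewrite Rabs_pos_eq; lra))).
    rewrite Rplus_0_l; unfold f; ring. }
  apply Ha1.
  set (e := Rmin x0 (Rmin 1 r)).
  assert (He : (0 < e)%R) by (repeat apply Rmin_pos; lra).
  assert (He1 : (e <= x0)%R) by apply Rmin_l.
  assert (He2 : (e <= Rmin 1 r)%R) by apply Rmin_r.
  assert (He3 : (Rmin 1 r <= 1)%R) by apply Rmin_l.
  assert (He4 : (Rmin 1 r <= r)%R) by apply Rmin_r.
  apply (cube_series_no_linear_term (fun k => fst (a k)) u n e He).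
  - now apply (conv_CV_radius rho).
  - rewrite <- Rabs_R0; apply HCV; rewrite Rabs_R0; easy.
  - intros x Hx; rewrite <- (sol_on_cubes rho b a x Ha) by lra.
    apply Hgu; split; [apply pow_lt; lra|apply Rmin_glb_lt].
    + assert (x * x < 1)%R by nra; simpl; nra.
    + assert (x * x < x0 * x0)%R by nra; simpl; nra.
Qed.

Lemma not_painleve : ~ painleve_property the_ode.
Proof.
  intros (S & HS & H).
  destruct (HS 0) as (r & Hr & Hr0).
  (* The disc of radius [r / 2] about [r / 2] avoids 0, which may be a puncture, and lies in the
     punctured disc about 0 that is free of punctures. *)
  set (b := RtoC (r / 2)%R).
  assert (Hdisc : forall z, (Cmod (z - b) < r / 2)%R -> ~ S z).
  { intros z Hz HSz; apply (Hr0 z HSz).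
    replace (z - 0) with z by ring.
    assert (Hb : Cmod b = (r / 2)%R) by (unfold b; rewrite Cmod_R, Rabs_pos_eq; lra).
    split.
    - apply Cmod_gt_0; intros ->.
      replace (0 - b) with (- b) in Hz by ring; rewrite Cmod_opp in Hz; lra.
    - replace z with (z - b + b) by ring.
      eapply Rle_lt_trans; [apply Cmod_triangle|lra]. }
  destruct (solution_coefficients b 0 0 0) as (e & Hstep & He & _).
  destruct (solution_converges b 0 0 0 e Hstep) as (rho & M & Hrho & HM).
  set (a := series_of 0 e) in *.
  assert (Ha : conv rho a).
  { intros s Hs; exists M; intros n; eapply Rle_trans; [|apply (HM n)].
    apply Rmult_le_compat_l; [apply Cmod_ge_0|apply pow_incr; lra]. }
  destruct (branch_not_extendable (fun z => ~ S z) b (r / 2) rho a)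
    as (x & Hx & Hxr & Hext); try assumption; [lra| |].
  { unfold a, series_of, fadd; simpl; lra. }
  destruct (sol_solves rho b a x Ha (cleared_lhs_reduced b 0 e He) Hx)
    as (r' & Hr' & Hsol).
  apply Hext; apply (H _ r'); [|easy|easy].
  apply Hdisc; replace (b + RtoC (x ^ 3) - b) with (RtoC (x ^ 3)) by ring.
  rewrite Cmod_R, Rabs_pos_eq; [easy|apply pow_le; lra].
Qed.

Theorem mainTheorem3 :
  ~ painleve_property the_ode /\
  forall b a0 a9 a11 : C,
    exists a : nat -> C,
      formal_solution b a /\
      a 0%nat = a0 /\
      a 1%nat = - (1) /\
      a 2%nat = 0 /\ a 3%nat = 0 /\ a 4%nat = 0 /\
      a 5%nat = - (6 / 7) * b /\
      a 6%nat = 0 /\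
      a 7%nat = 10 / 21 * a0 /\
      a 8%nat = - (3 / 2) /\
      a 9%nat = a9 /\
      a 10%nat = 0 /\
      a 11%nat = a11 /\
      a 12%nat = - (135 / 49) * b.
Proof.
  split; [exact not_painleve|exact formal_solution_exists].
Qed.
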